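(* Let $N\cong\mathbb{Z}^3$ be a lattice, let $\Delta_1\subseteq\Delta_2\subseteq N_{\mathbb{R}}$ be three-dimensional reflexive polytopes, and let $\widehat{\Sigma}(\Delta_1)$ be any MPCP subdivision of the fan $\Sigma(\Delta_1)$. Then there exists an MPCP subdivision $\widehat{\Sigma}(\Delta_2)$ of $\Sigma(\Delta_2)$ such that $\widehat{\Sigma}(\Delta_2)$ is a refinement of $\widehat{\Sigma}(\Delta_1)$.
   Context: Let $N\cong\mathbb{Z}^n$ be a lattice, $M = \mathrm{Hom}(N,\mathbb{Z})$, $N_{\mathbb{R}} = N\otimes\mathbb{R}$, $M_{\mathbb{R}} = M\otimes\mathbb{R}$, with pairing $\langle\cdot,\cdot\rangle : M_{\mathbb{R}}\times N_{\mathbb{R}}\to\mathbb{R}$. A lattice polytope $\Delta\subseteq N_{\mathbb{R}}$ with the origin in its interior is called reflexive if the dual polytope $\Delta^* = \{ m\in M_{\mathbb{R}} \mid \langle m,n\rangle\ge -1 \ \forall n\in\Delta\}$ is also a lattice polytope (with respect to $M$). The cone over a subset $S$ of a real vector space is $\mathbb{R}_{\ge 0}S = \{rs \mid r\in\mathbb{R}, r\ge 0, s\in S\}$. The fan $\Sigma(\Delta)$ consists of the cones over the proper faces of $\Delta$. An MPCP (maximal projective crepant partial) subdivision $\widehat{\Sigma}(\Delta)$ of $\Sigma(\Delta)$ is a fan subdividing $\Sigma(\Delta)$ which is projective (its toric variety is projective), whose maximal cones are cones over elementary simplices (lattice simplices containing no lattice points except their vertices), and such that the primitive integral generators of all its rays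 are lattice points in the boundary of $\Delta$. A complete fan $F_2$ is a refinement (subdivision) of a complete fan $F_1$ if every cone of $F_2$ is contained in a cone of $F_1$. *)

(* Defs.v *)
From HB Require Import structures.
From mathcomp Require Import all_boot all_order all_algebra.
From mathcomp Require Import all_classical all_reals all_analysis.

Set Implicit Arguments.
Unset Strict Implicit.
Unset Printing Implicit Defensive.

Import Order.TTheory GRing.Theory Num.Theory.
Import numFieldNormedType.Exports.

Local Open Scope classical_set_scope.
Local Open Scope ring_scope.

(* A basis of N is fixed, so that N is the lattice of integral row vectors in
   N_R = 'rV[R]_n, and M = Hom(N, Z) is, through the dual basis, the lattice
   of integral column vectors in M_R = 'cV[R]_n. *)

Definition lattice_point (R : realType) (p q : nat) (x : 'M[R]_(p, q)) : Prop :=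
  x \is a mxOver Num.int.

Definition pairing (R : realType) (n : nat) (m : 'cV[R]_n) (v : 'rV[R]_n) : R :=
  (v *m m) 0 0.

Section Convexity.
Context {R : realType} {E : lmodType R}.

Definition convex_hull (s : seq E) : set E :=
  [set x | exists c : nat -> R,
     [/\ forall i, 0 <= c i,
         \sum_(i < size s) c i = 1 &
         x = \sum_(i < size s) c i *: s`_i]].

Definition cone (S : set E) : set E :=
  [set x | exists r y, [/\ 0 <= r, S y & x = r *: y]].

Definition conic_hull (s : seq E) : set E :=
  [set x | exists c : nat -> R,
     (forall i, 0 <= c i) /\ x = \sum_(i < size s) c i *: s`_i].

Definition affinely_independent (s : seq E) : Prop :=
  forall c : nat -> R,
    \sum_(i < size s) c i = 0 -> \sum_(i < size s) c i *: s`_i = 0 ->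
    forall i, (i < size s)%N -> c i = 0.

End Convexity.

Definition boundary (T : topologicalType) (A : set T) : set T :=
  closure A `\` interior A.

(* Used both for N (row vectors) and for M (column vectors). *)
Definition lattice_polytope (R : realType) (p q : nat)
    (P : set 'M[R]_(p, q)) : Prop :=
  exists s : seq 'M[R]_(p, q),
    (forall x, x \in s -> lattice_point x) /\ P = convex_hull s.

Section Toric.
Context {R : realType} {n : nat}.
Notation NR := 'rV[R]_n.
Notation MR := 'cV[R]_n.

Definition dual_polytope (P : set NR) : set MR :=
  [set m | forall v, P v -> -1 <= pairing m v].

(* A set with nonempty interior is full-dimensional. *)
Definition reflexive_polytope (P : set NR) : Prop :=
  [/\ lattice_polytope P, interior P 0 & lattice_polytope (dual_polytope P)].

Definition polytope_face (P G : set NR) : Prop :=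
  exists (m : MR) (a : R),
    (forall v, P v -> a <= pairing m v) /\
    G = P `&` [set v | pairing m v = a].

(* [cone set0] is empty, so the zero cone, which corresponds to the empty face,
   is added separately. *)
Definition face_fan (P : set NR) : set (set NR) :=
  [set [set 0]] `|`
  [set cone G | G in [set G | [/\ polytope_face P G, G !=set0 & G <> P]]].

Definition rational_cone (sigma : set NR) : Prop :=
  exists s : seq NR,
    (forall v, v \in s -> lattice_point v) /\ sigma = conic_hull s.

Definition strongly_convex (sigma : set NR) : Prop :=
  forall v, sigma v -> sigma (- v) -> v = 0.

Definition cone_face (sigma tau : set NR) : Prop :=
  exists m : MR,
    (forall v, sigma v -> 0 <= pairing m v) /\
    tau = sigma `&` [set v | pairing m v = 0].

Record is_fan (F : set (set NR)) : Prop := IsFan {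
  fan_finite : finite_set F;
  fan_rational : forall sigma, F sigma -> rational_cone sigma;
  fan_strongly_convex : forall sigma, F sigma -> strongly_convex sigma;
  fan_face : forall sigma tau, F sigma -> cone_face sigma tau -> F tau;
  fan_meet : forall sigma tau, F sigma -> F tau ->
    cone_face sigma (sigma `&` tau) /\ cone_face tau (sigma `&` tau) }.

Definition complete_fan (F : set (set NR)) : Prop :=
  forall v : NR, exists2 sigma, F sigma & sigma v.

Definition refines (F2 F1 : set (set NR)) : Prop :=
  forall sigma, F2 sigma -> exists2 tau, F1 tau & sigma `<=` tau.

Definition maximal_cone (F : set (set NR)) (sigma : set NR) : Prop :=
  F sigma /\ forall tau, F tau -> sigma `<=` tau -> tau = sigma.

(* For a complete fan F, the toric variety X_F is projective if and only if it
   carries a torus-invariant ample Cartier divisor.  Such divisors correspond to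
   the strictly convex integral support functions phi of F: phi is convex, it is
   given on each maximal cone sigma by some m in M, and sigma is exactly the
   locus where phi agrees with that m. *)
Definition projective_fan (F : set (set NR)) : Prop :=
  exists phi : NR -> R,
    convex_function (E := NR) setT phi /\
    forall sigma, maximal_cone F sigma ->
      exists2 m : MR, lattice_point m &
        forall v, phi v = pairing m v <-> sigma v.

Definition elementary_simplex (S : set NR) : Prop :=
  exists s : seq NR,
    [/\ affinely_independent s,
        forall v, v \in s -> lattice_point v,
        S = convex_hull s &
        forall v, S v -> lattice_point v -> v \in s].

(* This excludes u = 0, since 0 = 0 *+ k for every k. *)
Definition primitive (u : NR) : Prop :=
  lattice_point u /\
  forall (w : NR) (k : nat), lattice_point w -> u = w *+ k -> k = 1%N.

(* The elementary simplices are taken inside the boundary of P, so that their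
   vertices are the primitive generators of the rays.  Without this, F need not
   use all boundary lattice points: if p = (v1 + v2 + v3) / 3 and the lattice is
   spanned by v1, v2, v3 and p, then the only lattice points of the triangle
   with vertices v1, v2, v3 are p and the vertices, but the cone over it is also
   the cone over the elementary simplex with vertices 2 v1, v2, v3. *)
Record MPCP (P : set NR) (F : set (set NR)) : Prop := IsMPCP {
  MPCP_fan : is_fan F;
  MPCP_complete : complete_fan F;
  MPCP_refines : refines F (face_fan P);
  MPCP_projective : projective_fan F;
  MPCP_maximal : forall sigma, maximal_cone F sigma ->
    exists S, [/\ elementary_simplex S, S `<=` boundary P & sigma = cone S];
  MPCP_rays : forall u, primitive u -> F (cone [set u]) -> boundary P u }.

End Toric.

(* Main.v *)
Require Import Defs.
From mathcomp Require Import all_boot all_order all_algebra.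
From mathcomp Require Import all_classical all_reals all_analysis.
From mathcomp Require Import ring lra zify.

(* All nonzero lattice points a_i of Delta2 lie on its boundary, by
   integrality of the gauge phi2 of Delta2.  Let phi1 be the strictly convex
   support function of Sigma1, and psi = phi1 + C phi2 with C large.

   The crucial point is that psi is the lower envelope of its values at the
   a_i, i.e. that the common refinement of Sigma1 and of the face fan has
   all its rays through boundary lattice points.  On a two-dimensional cone
   spanned by boundary lattice points p and q this holds because phi2 (p + q)
   is 1 or 2: if it is 2 then phi2 is linear on the cone, and if it is 1 then
   p + q is a boundary lattice point at which the cone can be cut.  The
   three-dimensional case is reduced to this one along segments.

   Sigma2 is the regular fan given by the integral heights
   h_i = N psi(a_i) + M |a_i|^2 + t^i with N >> M >> t: its cones are
   generated by the a_i at which a functional m with m(a_j) <= h_j for all j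
   is tight.  The leading term makes it refine Sigma1 and the face fan, the
   middle one forces every a_i to be used, and the last one makes it
   simplicial. *)

Set Implicit Arguments.
Unset Strict Implicit.
Unset Printing Implicit Defensive.

Import Order.TTheory GRing.Theory Num.Theory.
Import numFieldNormedType.Exports.

Local Open Scope classical_set_scope.
Local Open Scope ring_scope.

(** * The pairing of M and N, and lattice points *)

Section Pairing.
Context {R : realType} {n : nat}.
Implicit Types (m : 'cV[R]_n) (v : 'rV[R]_n).

Lemma pairingE m v : pairing m v = \sum_i v 0 i * m i 0.
Proof. by rewrite /pairing mxE. Qed.

Lemma pairingDl m m' v : pairing (m + m') v = pairing m v + pairing m' v.
Proof. by rewrite /pairing mulmxDr mxE. Qed.

Lemma pairingDr m v v' : pairing m (v + v') = pairing m v + pairing m v'.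
Proof. by rewrite /pairing mulmxDl mxE. Qed.

Lemma pairingZl r m v : pairing (r *: m) v = r * pairing m v.
Proof. by rewrite /pairing -scalemxAr mxE. Qed.

Lemma pairingZr r m v : pairing m (r *: v) = r * pairing m v.
Proof. by rewrite /pairing -scalemxAl mxE. Qed.

Lemma pairing0l v : pairing (0 : 'cV[R]_n) v = 0.
Proof. by rewrite /pairing mulmx0 mxE. Qed.

Lemma pairing0r m : pairing m 0 = 0.
Proof. by rewrite /pairing mul0mx mxE. Qed.

Lemma pairingNl m v : pairing (- m) v = - pairing m v.
Proof. by rewrite -scaleN1r pairingZl mulN1r. Qed.

Lemma pairingNr m v : pairing m (- v) = - pairing m v.
Proof. by rewrite -scaleN1r pairingZr mulN1r. Qed.

Lemma pairingBl m m' v : pairing (m - m') v = pairing m v - pairing m' v.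
Proof. by rewrite pairingDl pairingNl. Qed.

Lemma pairingBr m v v' : pairing m (v - v') = pairing m v - pairing m v'.
Proof. by rewrite pairingDr pairingNr. Qed.

Lemma pairing_sumr m (I : Type) (s : seq I) (P : pred I) (F : I -> 'rV[R]_n) :
  pairing m (\sum_(i <- s | P i) F i) = \sum_(i <- s | P i) pairing m (F i).
Proof.
by apply: (big_morph (pairing m)); [exact: pairingDr | exact: pairing0r].
Qed.

Lemma pairing_comb m (I : Type) (s : seq I) (P : pred I) (c : I -> R)
    (a : I -> 'rV[R]_n) :
  pairing m (\sum_(i <- s | P i) c i *: a i) =
    \sum_(i <- s | P i) c i * pairing m (a i).
Proof. by rewrite pairing_sumr; apply: eq_bigr => i _; rewrite pairingZr. Qed.

Lemma pairing_delta v i : pairing (delta_mx i 0) v = v 0 i.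
Proof.
rewrite pairingE (bigD1 i) //= mxE !eqxx mulr1 big1 ?addr0 // => j ji.
by rewrite mxE (negbTE ji) mulr0.
Qed.

Lemma pairing_inj v v' : (forall m, pairing m v = pairing m v') -> v = v'.
Proof. by move=> e; apply/rowP => i; rewrite -!pairing_delta. Qed.

Lemma pairing_tr_ge0 m : 0 <= pairing m m^T.
Proof.
by rewrite pairingE; apply: sumr_ge0 => i _; rewrite mxE -expr2 sqr_ge0.
Qed.

Lemma pairing_tr_eq0 m : (pairing m m^T == 0) = (m == 0).
Proof.
apply/idP/eqP => [|->]; last by rewrite pairing0l.
rewrite pairingE psumr_eq0 => [/allP h|i _]; last by rewrite mxE -expr2 sqr_ge0.
apply/colP => i; have := h i (mem_index_enum _).
by rewrite /= mxE mulf_eq0 orbb => /eqP ->; rewrite mxE.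
Qed.

Lemma pairing_tr_gt0 m : m != 0 -> 0 < pairing m m^T.
Proof. by move=> m0; rewrite lt_def pairing_tr_eq0 m0 pairing_tr_ge0. Qed.

Lemma lattice_pairing m v :
  lattice_point m -> lattice_point v -> pairing m v \is a Num.int.
Proof.
move=> /mxOverP hm /mxOverP hv; rewrite pairingE.
by apply: rpred_sum => i _; rewrite rpredM.
Qed.

Lemma lattice_pointD v v' :
  lattice_point v -> lattice_point v' -> lattice_point (v + v').
Proof.
by move=> /mxOverP h /mxOverP h'; apply/mxOverP => i j; rewrite mxE rpredD.
Qed.

End Pairing.

Lemma lattice_pointZn (R : realType) (p q : nat) (x : 'M[R]_(p, q)) (N : nat) :
  lattice_point x -> lattice_point (N%:R *: x).
Proof.
by move=> /mxOverP H; apply/mxOverP => i j; rewrite mxE rpredM ?rpred_nat.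
Qed.

Lemma int_gt0_ge1 (R : realType) (x : R) : x \is a Num.int -> 0 < x -> 1 <= x.
Proof.
move=> xi x0; have := norm_intr_ge1 xi; rewrite gtr0_norm //.
by apply; rewrite gt_eqF.
Qed.

(* The short algebraic proof of Farkas' lemma due to Bartl: if the first [k]
   functionals do not suffice, there is [x0] at which only the last one is
   positive, and projecting along [x0] eliminates the last functional. *)
Lemma farkas (R : realFieldType) (E : lmodType R) (k : nat)
    (al : nat -> E -> R) (ga : E -> R) :
  (forall i, linear_for *%R (al i)) -> linear_for *%R ga ->
  (forall x, (forall i, (i < k)%N -> al i x <= 0) -> ga x <= 0) ->
  exists c : nat -> R, (forall i, 0 <= c i) /\
    forall x, ga x = \sum_(i < k) c i * al i x.
Proof.
elim: k al ga => [|k IH] al ga lal lga H.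
  have lgaN x : ga (- x) = - ga x.
    have := lga (-1) x x; have := lga 1 x (- x).
    by rewrite !(scaleN1r, scale1r) addNr subrr; lra.
  have H0 x : ga x <= 0 by apply: H.
  exists (fun=> 0); split=> // x; rewrite big_ord0.
  by have := H0 x; have := H0 (- x); rewrite lgaN; lra.
have [Hk|] := pselect (forall x, (forall i, (i < k)%N -> al i x <= 0) -> ga x <= 0).
  have [c [c0 cE]] := IH al ga lal lga Hk.
  exists (fun i => if (i < k)%N then c i else 0); split=> [i|x].
    by case: ifP.
  rewrite big_ord_recr /= ltnn mul0r addr0 cE.
  by apply: eq_bigr => i _; rewrite ltn_ord.
move/existsNP => [x1 /not_implyP [x1k /negP]]; rewrite -ltNge => gax1.
have akx1 : 0 < al k x1.
  rewrite ltNge; apply/negP => h; move: gax1; rewrite ltNge => /negP; apply.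
  apply: H => i; rewrite ltnS leq_eqVlt => /orP[/eqP -> //|]; exact: x1k.
have lin (f : E -> R) : linear_for *%R f ->
    forall r x y, f (x - r *: y) = f x - r * f y.
  by move=> lf r x y; rewrite addrC -scaleNr lf mulNr addrC.
pose t x := al k x / al k x1.
have tl r x y : t (r *: x + y) = r * t x + t y by rewrite /t lal mulrDl mulrA.
pose pr f (x : E) : R := f x - t x * f x1.
have prE f : linear_for *%R f -> forall x, pr f x = f (x - t x *: x1).
  by move=> lf x; rewrite lin.
have prl f : linear_for *%R f -> linear_for *%R (pr f).
  by move=> lf r x y; rewrite /pr lf tl /=; ring.
have [c [c0 cE]] : exists c : nat -> R, (forall i, 0 <= c i) /\
    forall x, pr ga x = \sum_(i < k) c i * pr (al i) x.
  apply: (IH (fun i => pr (al i))) => [i||x hx]; [exact: prl|exact: prl|].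
  rewrite prE //; apply: H => i; rewrite ltnS leq_eqVlt => /orP[/eqP ->|ik].
    by rewrite lin // /t divfK ?gt_eqF // subrr.
  by rewrite -prE // hx.
(* This value is forced by the desired identity at [x1]. It is nonnegative since [ga x1 > 0] while
   the first [k] functionals are nonpositive at [x1]. *)
pose d := (ga x1 - \sum_(i < k) c i * al i x1) / al k x1.
exists (fun i => if (i < k)%N then c i else d); split=> [i|x].
  case: ifP => // _; rewrite divr_ge0 ?(ltW akx1) // subr_ge0.
  apply: le_trans (ltW gax1); apply: sumr_le0 => j _.
  by rewrite mulr_ge0_le0 // x1k.
rewrite big_ord_recr /= ltnn.
have -> : ga x = pr ga x + t x * ga x1 by rewrite /pr; ring.
rewrite cE (eq_bigr (fun i : 'I_k => c i * al i x - t x * (c i * al i x1))); last first.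
  by move=> i _; rewrite /pr; ring.
rewrite sumrB -mulr_sumr.
rewrite [in RHS](eq_bigr (fun i : 'I_k => c i * al i x)); last first.
  by move=> i _; rewrite ltn_ord.
by rewrite /d /t; field; rewrite gt_eqF.
Qed.

(** * Large integers and small perturbations *)

Lemma eventually_forall (J : finType) (P : J -> nat -> Prop) :
  (forall j, exists N0, forall N, (N0 <= N)%N -> P j N) ->
  exists N0, forall N, (N0 <= N)%N -> forall j, P j N.
Proof.
move=> /choice [f fP]; exists (\max_j f j) => N hN j; apply: fP.
exact: leq_trans (leq_bigmax j) hN.
Qed.

Lemma eventually_natr_ge (R : realType) (x : R) :
  exists N0, forall N, (N0 <= N)%N -> x <= N%:R.
Proof.
exists (Num.bound x) => N hN; apply: le_trans (ler_norm x) _.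
apply: le_trans (ltW (archi_boundP (normr_ge0 x))) _.
by rewrite ler_nat; apply: leq_trans hN; rewrite /Num.bound normr_id.
Qed.

(** Used to perturb a feasible functional: [al] is the slack of the constraints that are not tight
    and [be] the rate at which the perturbation consumes it. *)
Lemma exists_small (R : realType) (I : finType) (P : pred I) (al be : I -> R) :
  (forall i, P i -> 0 < al i) ->
  exists2 e, 0 < e & forall i, P i -> e * be i < al i.
Proof.
move=> al0; have [N0 /(_ _ (leqnn _)) hN] : exists N0, forall N, (N0 <= N)%N ->
    forall i, P i -> be i / al i <= N%:R.
  apply: eventually_forall => i; have [N0 h] := eventually_natr_ge (be i / al i).
  by exists N0 => N hN _; exact: h.
exists (N0.+1%:R)^-1 => [|i Pi]; first by rewrite invr_gt0.
rewrite mulrC ltr_pdivrMr ?ltr0n //.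
have := hN i Pi; rewrite ler_pdivrMr ?al0 // => h; apply: le_lt_trans h _.
by rewrite mulrC ltr_pM2l ?al0 // ltr_nat.
Qed.

(** * Fans defined by heights *)

Section HeightFan.
Context {R : realType} {n k : nat}.
Variables (a : 'I_k -> 'rV[R]_n) (h : 'I_k -> R).
Implicit Types (m mu : 'cV[R]_n) (v : 'rV[R]_n) (T : {set 'I_k}).

Definition feasible m := forall i, pairing m (a i) <= h i.

Definition tight m : {set 'I_k} := [set i | pairing m (a i) == h i].

Definition cone_on T : set 'rV[R]_n :=
  [set v | exists c : 'I_k -> R,
     (forall i, 0 <= c i) /\ v = \sum_(i in T) c i *: a i].

(** For [T = tight m] with [m] feasible, this says that [m] is a vertex of the polyhedron of
    feasible functionals. *)
Definition spanning T :=
  forall mu, (forall i, i \in T -> pairing mu (a i) = 0) -> mu = 0.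

(** This is the normal fan of the polyhedron of feasible functionals: every face of the polyhedron
    contributes the cone on the constraints tight in its relative interior. *)
Definition height_fan : set (set 'rV[R]_n) :=
  [set sigma | exists2 m, feasible m & sigma = cone_on (tight m)].

Lemma slack_gt0 m i : feasible m -> i \notin tight m -> 0 < h i - pairing m (a i).
Proof. by move=> Qm; rewrite inE subr_gt0 lt_neqAle Qm => ->. Qed.

Lemma cone_onS T T' : T \subset T' -> cone_on T `<=` cone_on T'.
Proof.
move=> /fintype.subsetP sT _ [c [c0 ->]].
exists (fun i => if i \in T then c i else 0); split=> [i|]; first by case: ifP.
rewrite big_mkcond [RHS]big_mkcond /=; apply: eq_bigr => i _.
by case: ifP => iT; [rewrite sT | rewrite scale0r if_same].
Qed.

Lemma cone_on_gen T i : i \in T -> cone_on T (a i).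
Proof.
move=> iT; exists (fun j => (j == i)%:R); split=> [j|]; first by rewrite ler0n.
rewrite (bigD1 i) //= eqxx scale1r big1 ?addr0 // => j /andP[_ /negbTE ->].
by rewrite scale0r.
Qed.

Lemma nth_map_enum T (j : 'I_#|T|) : [seq a i | i <- enum T]`_j = a (enum_val j).
Proof. by rewrite (nth_map (enum_val j)) -?cardE // -enum_val_nth. Qed.

Lemma index_enum_val T (j : 'I_#|T|) : index (enum_val j) (enum T) = j.
Proof. by rewrite (enum_val_nth (enum_val j)) index_uniq ?enum_uniq -?cardE. Qed.

Lemma cone_on_conic T : cone_on T = conic_hull [seq a i | i <- enum T].
Proof.
apply/seteqP; split=> v [c [c0 ->]].
  exists (fun j => if insub j is Some j' then c (@enum_val _ (mem T) j') else 0).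
  split=> [j|]; first by case: insub.
  rewrite size_map -cardE big_enum_val.
  by apply: eq_bigr => j _; rewrite valK nth_map_enum.
exists (fun i => c (index i (enum T))); split=> //.
rewrite size_map -cardE [RHS]big_enum_val.
by apply: eq_bigr => j _; rewrite nth_map_enum index_enum_val.
Qed.

Lemma convex_hull_on T : convex_hull [seq a i | i <- enum T] =
  [set v | exists c : 'I_k -> R, [/\ forall i, 0 <= c i, \sum_(i in T) c i = 1 &
    v = \sum_(i in T) c i *: a i]].
Proof.
apply/seteqP; split=> v [c [c0 c1 ->]].
  exists (fun i => c (index i (enum T))); split=> //.
    rewrite -[RHS]c1 size_map -cardE big_enum_val.
    by apply: eq_bigr => j _; rewrite index_enum_val.
  rewrite size_map -cardE [RHS]big_enum_val.
  by apply: eq_bigr => j _; rewrite nth_map_enum index_enum_val.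
exists (fun j => if insub j is Some j' then c (@enum_val _ (mem T) j') else 0).
split=> [j||]; first by case: insub.
  rewrite -[RHS]c1 size_map -cardE [RHS]big_enum_val.
  by apply: eq_bigr => j _; rewrite valK.
rewrite size_map -cardE big_enum_val.
by apply: eq_bigr => j _; rewrite valK nth_map_enum.
Qed.

Lemma pairing_cone_on m T (c : 'I_k -> R) : feasible m -> (forall i, 0 <= c i) ->
  pairing m (\sum_(i in T) c i *: a i) <= \sum_(i in T) c i * h i.
Proof.
by move=> Qm c0; rewrite pairing_comb; apply: ler_sum => i _; exact: ler_wpM2l.
Qed.

Lemma pairing_tight m (c : 'I_k -> R) :
  pairing m (\sum_(i in tight m) c i *: a i) = \sum_(i in tight m) c i * h i.
Proof.
by rewrite pairing_comb; apply: eq_bigr => i; rewrite inE => /eqP ->.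
Qed.

(* Complementary slackness. *)
Lemma cone_on_slack m m' (c : 'I_k -> R) : feasible m -> (forall i, 0 <= c i) ->
  let v := \sum_(i in tight m') c i *: a i in
  pairing m' v <= pairing m v ->
  v = \sum_(i in tight m' :&: tight m) c i *: a i.
Proof.
move=> Qm c0 v; rewrite pairing_tight pairing_comb => le.
have e : forall i, i \in tight m' -> c i * (h i - pairing m (a i)) = 0.
  have le' := ler_sum _ (fun i _ => ler_wpM2l (c0 i) (Qm i)).
  have /eqP := le_anti (introT andP (conj le (le' _ _))).
  rewrite -subr_eq0 -sumrB psumr_eq0 => [/allP e i iT|i _]; last first.
    by rewrite -mulrBr mulr_ge0 // subr_ge0.
  have := e i (mem_index_enum _); rewrite iT => /eqP <-; exact: mulrBr.
rewrite /v (bigID (mem (tight m))) /= [X in _ + X]big1 ?addr0; last first.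
  move=> i /andP[iT]; move: (e i iT) => /eqP; rewrite mulf_eq0.
  move=> /orP[/eqP -> _|]; first by rewrite scale0r.
  by rewrite subr_eq0 inE eq_sym => ->.
by apply: eq_bigl => i; rewrite finset.in_setI.
Qed.

(** The functional [m - m'] separates the two cones: on the cone of [m], [pairing m] gives the
    heights exactly and [pairing m'] at most that. Equality leaves only generators tight for both,
    by complementary slackness. *)
Lemma height_fan_meet_face m m' : feasible m -> feasible m' ->
  cone_face (cone_on (tight m)) (cone_on (tight m) `&` cone_on (tight m')).
Proof.
move=> Qm Qm'; exists (m - m'); split=> [v [c [c0 ->]]|].
  by rewrite pairingBl subr_ge0 pairing_tight pairing_cone_on.
apply/seteqP; split=> v [Hv].
  case: (Hv) => [c [c0 vE]] [c' [c'0 vE']]; split=> //=.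
  rewrite pairingBl; apply/eqP; rewrite subr_eq0 eq_le; apply/andP; split.
    by rewrite {2}vE' pairing_tight vE' pairing_cone_on.
  by rewrite {2}vE pairing_tight vE pairing_cone_on.
rewrite /= pairingBl => /eqP; rewrite subr_eq0 => /eqP e; split=> //.
case: Hv e => c [c0 vE] e; suff : cone_on (tight m :&: tight m') v.
  exact: cone_onS (subsetIr _ _) v.
by exists c; split=> //; rewrite {1}vE; apply: cone_on_slack => //; rewrite -vE e.
Qed.

(** If [mu] cuts out the face, a small move from [m] to [m - e *: mu] stays feasible and keeps tight
    exactly the generators on which [mu] vanishes. *)
Lemma height_fan_face m tau : feasible m -> cone_face (cone_on (tight m)) tau ->
  height_fan tau.
Proof.
move=> Qm [mu [mu0 ->]].
have mua i : i \in tight m -> 0 <= pairing mu (a i).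
  by move=> iT; apply: mu0; exact: cone_on_gen.
have [e e0 eP] := @exists_small R 'I_k (fun i => i \notin tight m)
  (fun i => h i - pairing m (a i)) (fun i => - pairing mu (a i))
  (fun i => slack_gt0 Qm).
have Qm' : feasible (m - e *: mu).
  move=> i; rewrite pairingBl pairingZl; have [iT|iT] := boolP (i \in tight m).
    have := mulr_ge0 (ltW e0) (mua i iT); have := Qm i; lra.
  by have := eP i iT; rewrite mulrN; lra.
have tE i : i \in tight (m - e *: mu) = (i \in tight m) && (pairing mu (a i) == 0).
  rewrite !inE pairingBl pairingZl; have [iT|iT] := boolP (i \in tight m); last first.
    have := eP i iT; rewrite inE in iT; rewrite (negbTE iT) mulrN => l.
    by apply/negbTE/eqP; lra.
  move: iT; rewrite inE => /eqP ->.
  rewrite eqxx /= -subr_eq0 addrAC subrr sub0r oppr_eq0.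
  by rewrite mulf_eq0 gt_eqF.
exists (m - e *: mu) => //; apply/seteqP; split=> v.
  case=> -[c [c0 ->]] /=; rewrite pairing_comb => /eqP.
  rewrite psumr_eq0 => [/allP e1|i iT]; last by rewrite mulr_ge0 ?mua.
  exists c; split=> //; rewrite (bigID (fun i => pairing mu (a i) == 0)) /=.
  rewrite [X in _ + X]big1 ?addr0; last first.
    move=> i /andP[iT ni]; have := e1 i (mem_index_enum _).
    by rewrite iT mulf_eq0 (negbTE ni) orbF => /eqP ->; rewrite scale0r.
  by apply: eq_bigl => i; rewrite tE.
move=> Hv; split.
  by apply: cone_onS Hv; apply/fintype.subsetP => i; rewrite tE => /andP[].
case: Hv => c [_ ->] /=; rewrite pairing_comb big1 // => i.
by rewrite tE => /andP[_ /eqP ->]; rewrite mulr0.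
Qed.

Section Complete.
Hypothesis h_gt0 : forall i, 0 < h i.
Hypothesis a_span : forall mu, mu != 0 -> exists i, 0 < pairing mu (a i).

(** If the tight constraints do not span, one can move along a direction vanishing on them until a
    further constraint becomes tight; the number of constraints that are not tight drops. *)
Lemma improve_vertex m v : feasible m -> exists m',
  [/\ feasible m', spanning (tight m'), tight m \subset tight m' &
      pairing m v <= pairing m' v].
Proof.
elim: {m}(k - #|tight m|)%N {-2}m (leqnn (k - #|tight m|)) => [|d IH] m hd Qm.
  exists m; split=> // mu hmu; apply/eqP; apply: contraT => /a_span[i].
  have : i \in tight m; last by move=> /hmu ->; rewrite ltxx.
  suff -> : tight m = [set: 'I_k]%SET by rewrite inE.
  apply/eqP; rewrite eqEcard finset.subsetT cardsT card_ord /=.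
  by move: hd; rewrite leqn0 subn_eq0.
have [sp|/existsNP[nu0 /not_implyP[nu0T /eqP nu00]]] := pselect (spanning (tight m)).
  by exists m.
have [nu [nu1 nuT nuv]] : exists nu, [/\ nu != 0,
    forall i, i \in tight m -> pairing nu (a i) = 0 & 0 <= pairing nu v].
  (* The sign of the direction is chosen so that the objective at [v] does not decrease. *)
  have [l|l] := leP 0 (pairing nu0 v); first by exists nu0.
  exists (- nu0); split; rewrite ?oppr_eq0 // ?pairingNl ?oppr_ge0 1?ltW // => i iT.
  by rewrite pairingNl nu0T ?oppr0.
have [i0 i0P] := a_span nu1.
(* [F i] is the step length at which constraint [i] becomes tight; the smallest one is taken, and
   [i0] shows that there is one. *)
pose F i := (h i - pairing m (a i)) / pairing nu (a i).
case: (@arg_minP _ _ _ i0 (fun i => 0 < pairing nu (a i)) F i0P) => i1 i1P i1m.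
have F0 : 0 <= F i1 by rewrite divr_ge0 ?subr_ge0 // ltW.
have Qm' : feasible (m + F i1 *: nu).
  move=> i; rewrite pairingDl pairingZl; have [l|l] := ltP 0 (pairing nu (a i)).
    by have := i1m i l; rewrite {2}/F ler_pdivlMr //; lra.
  by have := mulr_ge0_le0 F0 l; have := Qm i; lra.
have st : tight m \subset tight (m + F i1 *: nu).
  apply/fintype.subsetP => i iT; rewrite inE pairingDl pairingZl nuT // mulr0 addr0.
  by move: iT; rewrite inE.
have pt : tight m \proper tight (m + F i1 *: nu).
  rewrite properE st; apply/subsetPn; exists i1; last first.
    by apply/negP => /nuT e; rewrite e ltxx in i1P.
  by rewrite inE pairingDl pairingZl /F divfK ?(gt_eqF i1P) // addrC subrK.
have [|m' [Qm'' sp' st' le']] := IH (m + F i1 *: nu) _ Qm'.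
  have := proper_card pt; have := max_card (mem (tight (m + F i1 *: nu))).
  by rewrite card_ord; move: hd; lia.
exists m'; split=> //; first exact: fintype.subset_trans st st'.
by apply: le_trans le'; rewrite pairingDl pairingZl lerDl mulr_ge0.
Qed.

(** Farkas' lemma applied on M, where each [a i] acts as the functional [mu] to
    [pairing mu (a i)]. *)
Lemma cone_on_farkas T v :
  (forall mu, (forall i, i \in T -> pairing mu (a i) <= 0) -> pairing mu v <= 0) ->
  cone_on T v.
Proof.
move=> H; have [|||c [c0 cE]] := @farkas R 'cV[R]_n #|T|
  (fun j mu => pairing mu [seq a i | i <- enum T]`_j) (fun mu => pairing mu v).
- by move=> j r x y; rewrite pairingDl pairingZl.
- by move=> r x y; rewrite pairingDl pairingZl.
- move=> mu hmu; apply: H => i iT.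
  have := hmu (index i (enum T)); rewrite cardE index_mem mem_enum => /(_ iT).
  by rewrite (nth_map i) ?nth_index ?index_mem ?mem_enum.
rewrite cone_on_conic; exists c; split=> //; apply: pairing_inj => mu.
by rewrite cE size_map -cardE pairing_comb.
Qed.

(** Linear programming duality: take a vertex maximizing the pairing with [v] among the finitely
    many vertices. If [v] were outside its cone, Farkas would give a feasible direction increasing
    the pairing, and [improve_vertex] a better vertex. *)
Lemma height_fan_vertex v :
  exists m, [/\ feasible m, spanning (tight m) & cone_on (tight m) v].
Proof.
pose V T := exists m, [/\ feasible m, spanning (tight m) & tight m = T].
have [g gP] : exists g : {set 'I_k} -> 'cV[R]_n, forall T, V T ->
    [/\ feasible (g T), spanning (tight (g T)) & tight (g T) = T].
  have /choice [g gP] : forall T, exists m, V T ->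
      [/\ feasible m, spanning (tight m) & tight m = T].
    move=> T; have [[m Hm]|nV] := pselect (V T); first by exists m.
    by exists 0.
  by exists g.
have [m0 [Qm0 sm0 _ _]] : exists m', [/\ feasible m', spanning (tight m'),
    tight 0 \subset tight m' & pairing 0 v <= pairing m' v].
  by apply: improve_vertex => i; rewrite pairing0l ltW.
have V0 : `[< V (tight m0) >] by apply/asboolP; exists m0.
case: (@arg_maxP _ _ _ (tight m0) (fun T => `[< V T >]) (fun T => pairing (g T) v) V0).
move=> T /asboolP VT Tm; have [Qg sg gT] := gP _ VT.
exists (g T); split=> //; apply: cone_on_farkas => mu hmu.
rewrite leNgt; apply/negP => mv.
have [e e0 eP] := @exists_small R 'I_k (fun i => i \notin tight (g T))
  (fun i => h i - pairing (g T) (a i)) (fun i => pairing mu (a i))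
  (fun i => slack_gt0 Qg).
have Qm' : feasible (g T + e *: mu).
  move=> i; rewrite pairingDl pairingZl.
  have [iT|iT] := boolP (i \in tight (g T)); last by have := eP i iT; lra.
  by have := mulr_ge0_le0 (ltW e0) (hmu i iT); have := Qg i; lra.
have [m1 [Qm1 sm1 _]] := improve_vertex v Qm'.
rewrite pairingDl pairingZl => le1.
have V1 : V (tight m1) by exists m1.
have [_ _ t1] := gP _ V1.
(* A vertex is determined by its tight set, since the difference of two candidates vanishes on a
   spanning set. *)
have e1 : g (tight m1) = m1.
  apply/eqP; rewrite -subr_eq0; apply/eqP/sm1 => i iT; rewrite pairingBl.
  have := iT; rewrite -{1}t1 !inE => /eqP ->; move: iT; rewrite inE => /eqP ->.
  exact: subrr.
have /= := Tm _ (asboolT V1); rewrite e1; have := mulr_gt0 e0 mv; lra.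
Qed.

Lemma height_fan_complete : complete_fan height_fan.
Proof.
move=> v; have [m [Qm _ vm]] := height_fan_vertex v.
by exists (cone_on (tight m)) => //; exists m.
Qed.

Lemma maximal_height_fan sigma : maximal_cone height_fan sigma ->
  exists m, [/\ feasible m, spanning (tight m) & sigma = cone_on (tight m)].
Proof.
move=> [[m Qm ->] mx]; have [m' [Qm' sp st _]] := improve_vertex 0 Qm.
exists m'; split=> //; rewrite (mx (cone_on (tight m'))) //; first by exists m'.
exact: cone_onS.
Qed.

End Complete.

Lemma height_fan_is_fan :
  (forall i, lattice_point (a i)) ->
  (forall m, feasible m -> strongly_convex (cone_on (tight m))) ->
  is_fan height_fan.
Proof.
move=> lat sc; split.
- apply: (@sub_finite_set _ _ (range cone_on)); last exact: finite_image.
  by move=> _ [m _ ->]; exists (tight m).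
- move=> _ [m _ ->]; exists [seq a i | i <- enum (tight m)].
  by split; [move=> v /mapP[i _ ->]; exact: lat | exact: cone_on_conic].
- by move=> _ [m Qm ->]; exact: sc.
- by move=> _ tau [m Qm ->]; exact: height_fan_face.
- move=> _ _ [m Qm ->] [m' Qm' ->]; split; first exact: height_fan_meet_face.
  by rewrite setIC; exact: height_fan_meet_face.
Qed.

End HeightFan.

(** * Generic perturbations *)

Lemma eventually_affine_neq0 (R : realType) (al be : R) : be != 0 ->
  exists N0, forall N, (N0 <= N)%N -> N%:R * al + be != 0.
Proof.
move=> be0; have [->|al0] := eqVneq al 0.
  by exists 0%N => N _; rewrite mulr0 add0r.
have [N0 h] := eventually_natr_ge (`|be / al| + 1).
exists N0 => N /h hN; apply: contraTneq hN => e.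
have -> : be / al = - N%:R.
  apply: (mulIf al0); rewrite divfK // mulNr; move: e => /eqP.
  by rewrite addr_eq0 => /eqP ->; rewrite opprK.
by rewrite normrN normr_nat -ltNge ltrDl.
Qed.

Lemma exists_nat_nonroot (R : realType) (p : {poly R}) : p != 0 ->
  exists t : nat, p.[t%:R] != 0.
Proof.
move=> p0; apply: contrapT => /forallNP H.
have := @max_poly_roots R p [seq i%:R | i <- iota 0 (size p)] p0.
rewrite size_map size_iota ltnn map_inj_uniq ?iota_uniq => [|x y /eqP]; last first.
  by rewrite eqr_nat => /eqP.
suff -> : all (root p) [seq i%:R | i <- iota 0 (size p)] by move=> /(_ isT isT).
apply/allP => _ /mapP[i _ ->]; rewrite /root; have /negP := H i.
by rewrite negbK.
Qed.

Section Independence.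
Context {R : realType} {n k : nat}.
Variable a : 'I_k -> 'rV[R]_n.

Definition independent_on (T : {set 'I_k}) := forall c : 'I_k -> R,
  \sum_(i in T) c i *: a i = 0 -> forall i, i \in T -> c i = 0.

Lemma generic_powers : exists t : nat, forall T, ~ independent_on T ->
  exists2 c : 'I_k -> R, \sum_(i in T) c i *: a i = 0 &
    \sum_(i in T) c i * t%:R ^+ i != 0.
Proof.
have /choice [c cP] : forall T : {set 'I_k}, exists c : 'I_k -> R, ~ independent_on T ->
    \sum_(i in T) c i *: a i = 0 /\ exists2 i, i \in T & c i != 0.
  move=> T; have [H|] := pselect (independent_on T); first by exists (fun=> 0).
  move=> /existsNP[c /not_implyP[c0 /existsNP[i /not_implyP[iT /eqP ci]]]].
  by exists c => _; split=> //; exists i.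
pose co (T : {set 'I_k}) i := if i \in T then c T i else 0.
pose p T : {poly R} := \poly_(j < k) oapp (co T) 0 (insub j).
have pE T (i : 'I_k) : (p T)`_i = co T i by rewrite coef_poly ltn_ord valK.
pose P := \prod_(T | `[< ~ independent_on T >]) p T.
have P0 : P != 0.
  apply/prodf_neq0 => T /asboolP /cP[_ [i iT ci]].
  by apply: contra_neq ci => p0; move: (pE T i); rewrite p0 coef0 /co iT.
have [t tP] := exists_nat_nonroot P0.
exists t => T nT; exists (c T); first by have [] := cP T nT.
move: tP; rewrite /P horner_prod => /prodf_neq0 /(_ T (asboolT nT)).
rewrite horner_poly; congr (_ != _); rewrite [RHS]big_mkcond /=.
by apply: eq_bigr => i _; rewrite valK /= /co; case: ifP; rewrite ?mul0r.
Qed.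

End Independence.

(** * Support functions *)

Section SupportFunction.
Context {R : realType} {n : nat}.
Implicit Types (P : set 'cV[R]_n) (phi : 'rV[R]_n -> R).

(** [phi] is the pointwise maximum, attained, of the functionals in [P]. Sublinearity follows from
    this alone, so [P] can be a finite set of vertices or the set of linear pieces of a fan. *)
Definition support_function P phi :=
  (forall m, P m -> forall v, pairing m v <= phi v) /\
  (forall v, exists2 m, P m & phi v = pairing m v).

Section Theory.
Variables (P : set 'cV[R]_n) (phi : 'rV[R]_n -> R).
Hypothesis sP : support_function P phi.

Lemma support_homog r v : 0 <= r -> phi (r *: v) = r * phi v.
Proof.
case: sP => le ex r0; apply: le_anti; apply/andP; split.
  have [m Pm ->] := ex (r *: v); rewrite pairingZr.
  exact: ler_wpM2l (le m Pm v).
by have [m Pm ->] := ex v; rewrite -pairingZr le.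
Qed.

Lemma support0 : phi 0 = 0.
Proof. by rewrite -(scale0r (0 : 'rV[R]_n)) support_homog // mul0r. Qed.

Lemma support_sub v w : phi (v + w) <= phi v + phi w.
Proof.
case: sP => le ex; have [m Pm ->] := ex (v + w); rewrite pairingDr.
exact: lerD (le m Pm v) (le m Pm w).
Qed.

Lemma support_comb (I : finType) (T : {set I}) (c : I -> R) (a : I -> 'rV[R]_n) :
  (forall i, 0 <= c i) ->
  phi (\sum_(i in T) c i *: a i) <= \sum_(i in T) c i * phi (a i).
Proof.
case: sP => le ex c0; have [m Pm ->] := ex (\sum_(i in T) c i *: a i).
by rewrite pairing_comb; apply: ler_sum => i _; apply: ler_wpM2l => //; exact: le.
Qed.

(** A functional attaining the maximum at the sum satisfies termwise inequalities that add up to an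
    equality, so each of them is an equality. *)
Lemma support_common (I : finType) (T : {set I}) (a : I -> 'rV[R]_n) :
  \sum_(i in T) phi (a i) <= phi (\sum_(i in T) a i) ->
  exists2 m, P m & forall i, i \in T -> phi (a i) = pairing m (a i).
Proof.
case: sP => le ex; have [m Pm ->] := ex (\sum_(i in T) a i).
rewrite pairing_sumr => ge; exists m => // i iT.
have := le_anti (introT andP (conj ge (ler_sum _ (fun i _ => le m Pm (a i))))).
move=> /eqP; rewrite -subr_eq0 -sumrB psumr_eq0 => [|j _]; last by rewrite subr_ge0 le.
by move=> /allP /(_ i (mem_index_enum _)); rewrite iT subr_eq0 => /eqP.
Qed.

Lemma support_linear m r r' x y : P m -> 0 <= r -> 0 <= r' ->
  phi x = pairing m x -> phi y = pairing m y ->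
  phi (r *: x + r' *: y) = pairing m (r *: x + r' *: y).
Proof.
move=> Pm r0 r'0 ex ey; apply/le_anti; rewrite (sP.1 _ Pm) andbT.
apply: le_trans (support_sub _ _) _.
by rewrite !support_homog // ex ey pairingDr !pairingZr.
Qed.

Lemma support_int v : (forall m, P m -> lattice_point m) -> lattice_point v ->
  phi v \is a Num.int.
Proof.
by move=> P_lat lv; have [m /P_lat ml ->] := sP.2 v; exact: lattice_pairing.
Qed.

Lemma support_convex : convex_function (E := 'rV[R]_n) setT phi.
Proof.
move=> t x y _ _; rewrite /conv /=.
apply: le_trans (support_sub _ _) _; rewrite !support_homog ?ge0 //.
by rewrite subr_ge0; exact: le1.
Qed.

End Theory.

(** The support function of a Minkowski sum. *)
Lemma support_add P P' phi phi' (C : R) : 0 <= C ->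
  support_function P phi -> support_function P' phi' ->
  support_function [set m | exists m1 m2, [/\ P m1, P' m2 & m = m1 + C *: m2]]
    (fun v => phi v + C * phi' v).
Proof.
move=> C0 [le ex] [le' ex']; split=> [_ [m1 [m2 [P1 P2 ->]]] v|v].
  by rewrite pairingDl pairingZl lerD ?le // ler_wpM2l // le'.
have [m1 P1 e1] := ex v; have [m2 P2 e2] := ex' v.
exists (m1 + C *: m2); first by exists m1, m2.
by rewrite pairingDl pairingZl e1 e2.
Qed.

End SupportFunction.

(** * Integrality and projectivity of height fans *)

Section HeightFanLattice.
Context {R : realType} {n k : nat}.
Variables (a : 'I_k -> 'rV[R]_n) (h : 'I_k -> R).
Hypotheses (lat : forall i, lattice_point (a i)) (h_int : forall i, h i \is a Num.int).

(** Cramer's rule: [m] solves an invertible integral linear system with integral right-hand side, so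
    the determinant clears its denominators. *)
Lemma spanning_lattice (T : {set 'I_k}) : exists2 D : nat, (0 < D)%N &
  forall m, T \subset tight a h m -> spanning a T -> lattice_point (D%:R *: m).
Proof.
have [sp|nsp] := pselect (spanning a T); last by exists 1%N.
(* Rows outside [T] are set to zero, so that an invertible selection of rows can only use indices in
   [T]. *)
pose B : 'M[R]_(k, n) := \matrix_(i, j) (if i \in T then a i 0 j else 0).
have Bfull : row_full B.
  rewrite /row_full -mxrank_tr -/(row_free _) -kermx_eq0; apply/eqP/row_matrixP => i.
  have : row i (kermx B^T) *m B^T = 0 by rewrite -row_mul mulmx_ker row0.
  set w := row i _; rewrite row0 => wB.
  suff : w^T = 0 by move/(congr1 trmx); rewrite trmxK trmx0.
  apply: sp => j jT; rewrite pairingE.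
  have := congr1 (fun M : 'rV_k => M 0 j) wB; rewrite !mxE => wB'; rewrite -[RHS]wB'.
  by apply: eq_bigr => l _; rewrite !mxE jT mulrC.
have Cu := fullrowsub_unit Bfull; set C := rowsub _ _ in Cu.
pose f := fullrankfun Bfull.
have Ci : C = map_mx intr (map_mx Num.floor C).
  apply/matrixP => i j; rewrite !mxE floorK //; case: ifP => // _.
  by have /mxOverP := lat (f i); apply.
set C' := map_mx Num.floor C in Ci.
have dC : \det C = (\det C')%:~R by rewrite Ci -det_map_mx.
exists `|\det C'|%N.
  rewrite absz_gt0; apply: contraTneq Cu => d0.
  by rewrite unitmxE unitfE dC d0 eqxx.
move=> m /fintype.subsetP tm _.
have key : \det C *: m = \adj C *m (C *m m).
  by rewrite mulmxA mul_adj_mx mul_scalar_mx.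
have fT i : f i \in T.
  apply: contraT => fi; suff : row i C = 0.
    move=> r0; have : row i C *m invmx C = 0 by rewrite r0 mul0mx.
    rewrite -row_mul mulmxV // => /rowP /(_ i) /eqP.
    by rewrite !mxE eqxx oner_eq0.
  by apply/rowP => j; rewrite !mxE (negbTE fi).
have l1 : lattice_point (\det C *: m).
  rewrite key; apply/mxOverP => i j; rewrite mxE; apply: rpred_sum => l _.
  apply: rpredM.
    by rewrite Ci -map_mx_adj mxE intr_int.
  have -> : (C *m m) l j = h (f l); last exact: h_int.
    have := tm _ (fT l); rewrite inE pairingE (ord1 j) mxE => /eqP <-.
    by apply: eq_bigr => o _; rewrite !mxE fT.
rewrite natr_absz intr_norm -dC.
case: (ger0P (\det C)) => _ //.
apply/mxOverP => i j; rewrite scaleNr mxE rpredN.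
by move/mxOverP: l1; apply.
Qed.

Lemma spanning_lattice_uniform : exists2 D : nat, (0 < D)%N &
  forall m, spanning a (tight a h m) -> lattice_point (D%:R *: m).
Proof.
have /choice [d dP] : forall T : {set 'I_k}, exists D : nat, (0 < D)%N /\
    forall m, T \subset tight a h m -> spanning a T -> lattice_point (D%:R *: m).
  by move=> T; have [D D0 H] := spanning_lattice T; exists D.
exists (\prod_T d T)%N; first by apply: prodn_gt0 => T; have [] := dP T.
move=> m sp; rewrite (bigD1 (tight a h m)) //= mulnC natrM -scalerA.
by apply: lattice_pointZn; have [_] := dP (tight a h m); apply.
Qed.

(** The support function is the maximum over the feasible functionals, scaled by [D] so that every
    vertex becomes integral. Complementary slackness identifies the locus where a vertex attains the
    maximum with its cone. *)
Lemma height_fan_projective :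
  (forall i, 0 < h i) ->
  (forall mu, mu != 0 -> exists i, 0 < pairing mu (a i)) ->
  projective_fan (height_fan a h).
Proof.
move=> h0 asp; have [D D0 DP] := spanning_lattice_uniform.
have [M MP] := choice (height_fan_vertex h0 asp).
pose phi v := D%:R * pairing (M v) v.
have D0' : 0 < D%:R :> R by rewrite ltr0n.
have le m v : feasible a h m -> pairing m v <= pairing (M v) v.
  move=> Qm; have [_ _ [c [c0 vE]]] := MP v.
  by rewrite {1 3}vE pairing_tight pairing_cone_on.
exists phi; split.
  apply: (@support_convex _ _ [set m | exists2 m', feasible a h m' & m = D%:R *: m']).
  split=> [_ [m Qm ->] v|v]; first by rewrite pairingZl ler_pM2l // le.
  by have [Qm _ _] := MP v; exists (D%:R *: M v); [exists (M v) | rewrite pairingZl].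
move=> sigma /(maximal_height_fan asp)[m [Qm sp ->]].
exists (D%:R *: m); first exact: DP.
move=> v; rewrite /phi pairingZl; split=> [/(mulfI (lt0r_neq0 D0')) e|[c [c0 vE]]].
  have [QM _ [c [c0 vE]]] := MP v; apply: (cone_onS (subsetIr (tight a h (M v)) _)).
  exists c; split=> //; rewrite {1}vE; apply: cone_on_slack => //.
  by rewrite -vE e.
congr (_ * _); apply: le_anti; rewrite le // andbT.
by have [QM _ _] := MP v; rewrite {2 3}vE pairing_tight pairing_cone_on.
Qed.

End HeightFanLattice.

(** * Choice of the heights *)

Section Heights.
Context {R : realType} {n k : nat}.
Variables (a : 'I_k -> 'rV[R]_n) (P : set 'cV[R]_n) (psi : 'rV[R]_n -> R).
Hypothesis lat : forall i, lattice_point (a i).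
Hypothesis a_inj : injective a.
Hypothesis psi_support : support_function P psi.
Hypothesis psi_int : forall i, psi (a i) \is a Num.int.
Hypothesis psi_gt0 : forall i, 0 < psi (a i).

Let sq i : R := pairing (a i)^T (a i).

Let lat_tr i : lattice_point (a i)^T.
Proof. by apply/mxOverP => p q; rewrite mxE; have /mxOverP := lat i; apply. Qed.

(** The squared Euclidean distance of [a i] and [a j], expanded. *)
Let dist i j := sq i - 2 * pairing (a i)^T (a j) + sq j.

Let pairing_trC i j : pairing (a i)^T (a j) = pairing (a j)^T (a i).
Proof. by rewrite !pairingE; apply: eq_bigr => l _; rewrite !mxE mulrC. Qed.

Let dist_ge1 i j : i != j -> 1 <= dist i j.
Proof.
move=> ij; apply: int_gt0_ge1.
  by rewrite /dist /sq rpredD ?rpredB ?rpredM ?rpred_nat ?lattice_pairing.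
have -> : dist i j = pairing (a i - a j)^T (((a i - a j)^T)^T).
  rewrite trmxK linearB /= pairingBl !pairingBr (pairing_trC j i) /dist /sq; ring.
apply: pairing_tr_gt0; apply: contra_neq ij => e; apply: a_inj; apply/eqP.
by rewrite -subr_eq0 -[_ - _]trmxK e trmx0.
Qed.

(* Since distinct lattice points are at distance at least 1, the term
   [M * sq i] outweighs any perturbation [r] bounded by [M]. *)
Let strictly_convex (M : R) (r : 'I_k -> R) (T : {set 'I_k}) (c : 'I_k -> R) j :
  (forall i, 0 <= r i) -> (forall i, r i <= M) ->
  (forall i, 0 <= c i) -> \sum_(i in T) c i = 1 ->
  a j = \sum_(i in T) c i *: a i ->
  M * sq j + r j <= \sum_(i in T) c i * (M * sq i + r i).
Proof.
move=> r0 rM c0 c1 aj.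
have : 0 <= \sum_(i in T) c i * (M * dist i j + r i - r j).
  apply: sumr_ge0 => i _; apply: mulr_ge0 => //.
  have [->|ij] := eqVneq i j.
    suff -> : dist j j = 0 by rewrite mulr0 add0r subrr.
    rewrite /dist /sq; ring.
  have := dist_ge1 ij; have := r0 i; have := rM j; have := r0 j => x1 x2 x3 x4.
  have M0 : 0 <= M by lra.
  have := ler_wpM2l M0 x4; lra.
suff -> : \sum_(i in T) c i * (M * dist i j + r i - r j) =
    \sum_(i in T) c i * (M * sq i + r i) - (M * sq j + r j) by rewrite subr_ge0.
have e1 : \sum_(i in T) c i * pairing (a j)^T (a i) = sq j by rewrite /sq {3}aj pairing_comb.
rewrite (eq_bigr (fun i => c i * (M * sq i + r i) - 2 * M * (c i * pairing (a j)^T (a i))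
  + c i * (M * sq j - r j))); last first.
  by move=> i _; rewrite /dist (pairing_trC i j); ring.
by rewrite big_split sumrB /= -mulr_sumr -mulr_suml c1 e1; ring.
Qed.

(** The parameters are fixed in the order [t], [M], [N], each large with respect to the previous
    ones. There are finitely many sets [T], so one choice serves all of them. *)
Lemma exists_heights :
  (forall v, exists c : 'I_k -> R, [/\ forall i, 0 <= c i,
     v = \sum_i c i *: a i & \sum_i c i * psi (a i) <= psi v]) ->
  exists h : 'I_k -> R, [/\ forall i, h i \is a Num.int, forall i, 0 < h i &
    forall m, feasible a h m ->
    [/\ independent_on a (tight a h m),
        \sum_(i in tight a h m) psi (a i) <= psi (\sum_(i in tight a h m) a i) &
        forall (c : 'I_k -> R) j, (forall i, 0 <= c i) ->
          \sum_(i in tight a h m) c i = 1 ->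
          a j = \sum_(i in tight a h m) c i *: a i -> j \in tight a h m]].
Proof.
move=> rep; have [t tP] := generic_powers a.
have /choice [l lP] : forall T, exists c : 'I_k -> R, ~ independent_on a T ->
    \sum_(i in T) c i *: a i = 0 /\ \sum_(i in T) c i * t%:R ^+ i != 0.
  move=> T; have [H|/tP[c c0 c1]] := pselect (independent_on a T); first by exists (fun=> 0).
  by exists c.
pose r (i : 'I_k) : R := t%:R ^+ i.
have r0 i : 0 <= r i by rewrite exprn_ge0 ?ler0n.
(* For each dependent [T], the relation [l T] annihilates the heights for at most one value of [M];
   large values avoid it. The same argument is used for [N] below. *)
have [M0 HM] : exists M0, forall M, (M0 <= M)%N -> forall T, ~ independent_on a T ->
    M%:R * (\sum_(i in T) l T i * sq i) + \sum_(i in T) l T i * r i != 0.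
  apply: eventually_forall => T; have [iT|/lP[_ H]] := pselect (independent_on a T).
    by exists 0%N.
  have [N0 H0] := eventually_affine_neq0 (\sum_(i in T) l T i * sq i) H.
  by exists N0 => N /H0.
have [M1 HM1] := eventually_natr_ge (\sum_i r i).
pose M := maxn M0 M1.
have rM i : r i <= M%:R.
  apply: le_trans (HM1 M (leq_maxr _ _)); rewrite (bigD1 i) //= lerDl.
  exact: sumr_ge0.
have {}HM T : ~ independent_on a T -> \sum_(i in T) l T i * (M%:R * sq i + r i) != 0.
  move=> nT; have := HM M (leq_maxl _ _) T nT; rewrite mulr_sumr -big_split /=.
  by congr (_ != _); apply: eq_bigr => i _; ring.
pose p i := M%:R * sq i + r i.
have p0 i : 0 <= p i.
  by rewrite addr_ge0 // mulr_ge0 ?ler0n // /sq -{2}[a i]trmxK pairing_tr_ge0.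
have [N1 HN1] : exists N0, forall N, (N0 <= N)%N -> forall T, ~ independent_on a T ->
    N%:R * (\sum_(i in T) l T i * psi (a i)) + \sum_(i in T) l T i * p i != 0.
  apply: eventually_forall => T; have [iT|/HM H] := pselect (independent_on a T).
    by exists 0%N.
  have [N0 H0] := eventually_affine_neq0 (\sum_(i in T) l T i * psi (a i)) H.
  by exists N0 => N /H0.
(* [d T] decomposes the sum of the [a i] over [T] at the cost allowed by [psi]; it competes with the
   obvious decomposition whenever [gap T > 0]. *)
have [d dP] := choice (fun T : {set 'I_k} => rep (\sum_(i in T) a i)).
pose gap (T : {set 'I_k}) := \sum_(i in T) psi (a i) - psi (\sum_(i in T) a i).
have [N2 HN2] : exists N0, forall N, (N0 <= N)%N -> forall T, 0 < gap T ->
    \sum_i d T i * p i - \sum_(i in T) p i < N%:R * gap T.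
  apply: eventually_forall => T; have [g0|] := ltP 0 (gap T); last by exists 0%N.
  have [N0 H0] := eventually_natr_ge ((\sum_i d T i * p i - \sum_(i in T) p i) / gap T + 1).
  exists N0 => N /H0 HN _; rewrite -ltr_pdivrMr //; apply: lt_le_trans HN.
  by rewrite ltrDl.
(* The successor makes [N] positive. *)
pose N := (maxn N1 N2).+1.
have N1N : (N1 <= N)%N by rewrite leqW // leq_maxl.
have N2N : (N2 <= N)%N by rewrite leqW // leq_maxr.
have N0 : 0 < N%:R :> R by rewrite ltr0n.
pose h i := N%:R * psi (a i) + p i.
exists h; split=> [i|i|m Qm].
- by rewrite /h /p /r /sq !(rpredD, rpredM, rpredX) ?rpred_nat // lattice_pairing.
- by rewrite /h ltr_wpDr // mulr_gt0.
have hsum (T : {set 'I_k}) (c : 'I_k -> R) : \sum_(i in T) c i * h i =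
    N%:R * \sum_(i in T) c i * psi (a i) + \sum_(i in T) c i * p i.
  by rewrite mulr_sumr -big_split /=; apply: eq_bigr => i _; rewrite /h; ring.
split.
(* On a tight set the heights are values of [m], so a relation among the generators annihilates them
   too, against the choice of [N]. *)
- apply: contrapT => nT; have := HN1 N N1N _ nT; rewrite -hsum -pairing_tight.
  by have [-> _] := lP _ nT; rewrite pairing0r eqxx.
(* Evaluating [m] at the sum through both decompositions bounds [N] times the gap by a quantity
   independent of [N], against the choice of [N2]. *)
- rewrite leNgt -subr_gt0; apply/negP => g0.
  have := HN2 N N2N (tight a h m) g0.
  have [] := dP (tight a h m); move: (d _) => c c0 vE le.
  have := pairing_tight a h m (fun=> 1); rewrite hsum.
  under eq_bigr do rewrite scale1r.
  under [X in _ = _ * X + _]eq_bigr do rewrite mul1r.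
  under [X in _ = _ + X]eq_bigr do rewrite mul1r.
  have : pairing m (\sum_(i in tight a h m) a i) <=
      N%:R * (\sum_i c i * psi (a i)) + \sum_i c i * p i.
    rewrite vE pairing_comb mulr_sumr -big_split /=; apply: ler_sum => i _.
    apply: le_trans (ler_wpM2l (c0 i) (Qm i)) _.
    by rewrite /h le_eqVlt; apply/orP; left; apply/eqP; ring.
  have := ler_wpM2l (ltW N0) le; rewrite /gap mulrBr; lra.
(* Convexity of both terms of the heights gives [h j <= pairing m (a j)]; feasibility is the reverse
   inequality. *)
- move=> c j c0 c1 aj; rewrite inE; apply/eqP/le_anti; rewrite Qm /=.
  rewrite {1}aj pairing_tight hsum /h.
  apply: lerD; last exact: strictly_convex.
  rewrite ler_pM2l // {1}aj; exact: (support_comb psi_support).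
Qed.

End Heights.

(** * Reflexive polytopes *)

Section ConvexHull.
Context {R : realType} {E : lmodType R}.

Lemma mem_convex_hull (s : seq E) x : x \in s -> convex_hull s x.
Proof.
move=> xs; exists (fun i => (i == index x s)%:R); split=> [i||].
- exact: ler0n.
- have ix : (index x s < size s)%N by rewrite index_mem.
  rewrite (bigD1 (Ordinal ix)) //= eqxx big1 ?addr0 // => j.
  by rewrite -val_eqE /= => /negbTE ->.
- have ix : (index x s < size s)%N by rewrite index_mem.
  rewrite (bigD1 (Ordinal ix)) //= eqxx scale1r nth_index // big1 ?addr0 // => j.
  by rewrite -val_eqE /= => /negbTE ->; rewrite scale0r.
Qed.

End ConvexHull.

Section Hull.
Context {R : realType} {n : nat}.

Lemma convex_hull_le (s : seq 'rV[R]_n) (m : 'cV[R]_n) b :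
  (forall g, g \in s -> pairing m g <= b) ->
  forall x, convex_hull s x -> pairing m x <= b.
Proof.
move=> H _ [c [c0 c1 ->]]; rewrite pairing_comb.
rewrite -[leRHS]mul1r -c1 mulr_suml; apply: ler_sum => i _.
by apply: ler_wpM2l => //; apply: H; exact: mem_nth.
Qed.

Lemma seq_argmax (T : eqType) (f : T -> R) (s : seq T) : s != [::] ->
  exists2 x, x \in s & forall y, y \in s -> f y <= f x.
Proof.
elim: s => // x s IH _; have [->|/IH[z zs zmax]] := eqVneq s [::].
  by exists x; rewrite ?mem_head // => y; rewrite inE => /eqP ->.
have [l|l] := leP (f x) (f z).
  exists z; first by rewrite inE zs orbT.
  by move=> y; rewrite inE => /orP[/eqP -> //|]; exact: zmax.
exists x; first by rewrite mem_head.
by move=> y; rewrite inE => /orP[/eqP -> //|/zmax yz]; exact: le_trans yz (ltW l).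
Qed.

Lemma seq_support (t : seq 'cV[R]_n) : t != [::] ->
  exists phi, support_function [set m | m \in t] phi.
Proof.
move=> t0; have /choice[f fP] : forall v, exists m, m \in t /\
    forall m', m' \in t -> pairing m' v <= pairing m v.
  by move=> v; have [m mt H] := seq_argmax (fun m => pairing m v) t0; exists m.
exists (fun v => pairing (f v) v); split=> [m mt v|v]; have [ft H] := fP v.
  exact: H.
by exists (f v).
Qed.

(** Farkas' lemma on affine functionals, encoded as pairs in M x R. The pair [(0, 1)] yields that
    the coefficients sum to 1, and the pairs [(mu, 0)] yield the point itself. *)
Lemma convex_hull_farkas (s : seq 'rV[R]_n) x :
  (forall (mu : 'cV[R]_n) (c : R), (forall g, g \in s -> pairing mu g + c <= 0) ->
     pairing mu x + c <= 0) ->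
  convex_hull s x.
Proof.
move=> H; have [|||c [c0 cE]] := @farkas R ('cV[R]_n * R^o)%type (size s)
  (fun j p => pairing p.1 s`_j + p.2) (fun p => pairing p.1 x + p.2).
- by move=> j r p q /=; rewrite pairingDl pairingZl /GRing.scale /=; ring.
- by move=> r p q /=; rewrite pairingDl pairingZl /GRing.scale /=; ring.
- move=> p hp; apply: H => g gs.
  by have := hp (index g s); rewrite index_mem nth_index //; apply.
exists c; split=> //.
  have /= := cE (0, 1); rewrite pairing0l add0r => ->.
  by apply: eq_bigr => i _; rewrite pairing0l add0r mulr1.
apply: pairing_inj => mu; rewrite pairing_comb.
have /= := cE (mu, 0); rewrite addr0 => ->.
by apply: eq_bigr => i _; rewrite addr0.
Qed.

End Hull.

Section Reflexive.
Context {R : realType} {n : nat}.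
Variable D : set 'rV[R]_n.
Hypothesis rD : reflexive_polytope D.

Lemma interior0_absorbing : exists2 e, 0 < e & forall v : 'rV[R]_n, `|v| < e -> D v.
Proof.
case: rD => _ /nbhs_ballP[e e0 eD] _; exists e => // v ve; apply: eD.
by rewrite -ball_normE /= sub0r normrN.
Qed.

Lemma scaled_absorbing (v : 'rV[R]_n) : exists2 r, 0 < r & D (r *: v).
Proof.
have [e e0 eD] := interior0_absorbing.
have v1 : 0 < `|v| + 1 by rewrite ltr_wpDl.
exists (e / (`|v| + 1)); first exact: divr_gt0.
apply: eD; rewrite normrZ gtr0_norm ?divr_gt0 // mulrAC ltr_pdivrMr //.
by rewrite ltr_pM2l // ltrDl.
Qed.

(** [P] consists of the negatives of generators of the dual polytope, which are integral by
    reflexivity; the sign comes from the bound -1 in the dual. That [phi v <= 1] implies [D v] is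
    the bipolar theorem. *)
Lemma reflexive_support : exists (s : seq 'rV[R]_n) (P : set 'cV[R]_n) (phi : 'rV[R]_n -> R),
  [/\ D = convex_hull s /\ (forall g, g \in s -> lattice_point g),
      support_function P phi, (forall m, P m -> lattice_point m) &
      forall v, D v <-> phi v <= 1].
Proof.
case: (rD) => -[s [slat Ds]] _ [t [tlat Dt]].
have D0 : D 0 by have [e e0 eD] := interior0_absorbing; apply: eD; rewrite normr0.
have dual0 : dual_polytope D 0 by move=> v _; rewrite pairing0l lerN10.
have t0 : [seq - m | m <- t] != [::].
  apply/eqP; case: t Dt {tlat} => // Dt _.
  move: dual0; rewrite Dt => -[c [_ + _]]; rewrite big_ord0 => /eqP.
  by rewrite eq_sym oner_eq0.
have [phi sphi] := seq_support t0; exists s, [set m | m \in [seq - m | m <- t]], phi.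
split=> //.
  move=> _ /mapP[m /tlat /mxOverP mlat ->].
  by apply/mxOverP => i j; rewrite mxE rpredN.
case: sphi => le ex v; split=> [Dv|].
  have [_ /mapP[m mt ->] ->] := ex v.
  have : dual_polytope D m by rewrite Dt; exact: mem_convex_hull.
  by move=> /(_ v Dv); rewrite pairingNl lerNl.
move=> phiv; rewrite Ds; apply: convex_hull_farkas => mu c Hmu.
have HD y : D y -> pairing mu y <= - c.
  by rewrite Ds; apply: convex_hull_le => g /Hmu; lra.
have dualv m : dual_polytope D m -> -1 <= pairing m v.
  rewrite Dt => -[d [d0 d1 ->]]; have : pairing (- (\sum_(i < size t) d i *: t`_i)) v <= 1.
    rewrite /pairing -sumrN mulmx_sumr summxE -d1; apply: ler_sum => i _.
    rewrite -scalerN -scalemxAr mxE -[leRHS]mulr1; apply: ler_wpM2l => //.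
    by apply: le_trans (le (- t`_i) _ v) phiv; apply: map_f; exact: mem_nth.
  by rewrite pairingNl; lra.
(* As 0 is in [D], [c <= 0]. If [c = 0], then [mu = 0] because [D] is absorbing; if [c < 0], then
   [c^-1 *: mu] is in the dual polytope. *)
have := HD 0 D0; rewrite pairing0r oppr_ge0 le_eqVlt => /predU1P[c0|c0].
  have [r r0 Dr] := scaled_absorbing mu^T; have := HD _ Dr.
  rewrite pairingZr c0 oppr0 pmulr_rle0 // => mule.
  suff -> : mu = 0 by rewrite pairing0l addr0.
  by apply/eqP; rewrite -pairing_tr_eq0 eq_le mule pairing_tr_ge0.
have /dualv : dual_polytope D (c^-1 *: mu).
  move=> y /HD; rewrite pairingZl mulrC ler_ndivlMr //; lra.
by rewrite pairingZl mulrC ler_ndivlMr //; lra.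
Qed.

Section Gauge.
Variables (P : set 'cV[R]_n) (phi : 'rV[R]_n -> R).
Hypotheses (sphi : support_function P phi) (Dphi : forall v, D v <-> phi v <= 1).

(** Otherwise the whole ray through [v] would lie in [D], which is bounded in the direction of
    [v]. *)
Lemma gauge_gt0 v : v != 0 -> 0 < phi v.
Proof.
move=> v0; rewrite ltNge; apply/negP => phi_le.
case: rD => -[s [_ Ds]] _ _.
have Hv r : 0 <= r -> D (r *: v).
  move=> r0; apply/Dphi; rewrite (support_homog sphi) //.
  by have := mulr_ge0_le0 r0 phi_le; lra.
have bound : exists b, forall g, g \in s -> pairing v^T g <= b.
  case: s {Ds} => [|x s]; first by exists 0.
  have [g _ H] := seq_argmax (pairing v^T) (isT : x :: s != [::]).
  by exists (pairing v^T g).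
case: bound => b Hb.
have vv : 0 < pairing v^T v.
  rewrite -{2}[v]trmxK pairing_tr_gt0 //; apply: contra_neq v0 => e.
  by rewrite -[v]trmxK e trmx0.
have r0 : 0 <= (`|b| + 1) / pairing v^T v by rewrite divr_ge0 ?addr_ge0 // ltW.
have := Hv _ r0; rewrite Ds => /(convex_hull_le Hb).
by rewrite pairingZr divfK ?gt_eqF //; have := ler_norm b; lra.
Qed.

Lemma gauge_small : exists2 e, 0 < e & forall v : 'rV[R]_n, `|v| < e -> phi v <= 1.
Proof.
by have [e e0 eD] := interior0_absorbing; exists e => // v /eD /Dphi.
Qed.

Lemma reflexive_boundary v : boundary D v <-> phi v = 1.
Proof.
have [e e0 eD] := gauge_small.
(* A quantitative continuity of [phi] at 0, which subadditivity transports to every point. *)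
have near r (w : 'rV[R]_n) : 0 < r -> `|w| < e * r -> phi w <= r.
  move=> r0 wr; have : phi (r^-1 *: w) <= 1.
    apply: eD; rewrite normrZ gtr0_norm ?invr_gt0 // mulrC ltr_pdivrMr //.
  by rewrite (support_homog sphi) ?invr_ge0 ?(ltW r0) // mulrC ler_pdivrMr // mul1r.
split=> [[clv niv]|phiv].
  apply/eqP; rewrite eq_le; apply/andP; split; rewrite leNgt; apply/negP => l.
    pose r := (phi v - 1) / 2; have r0 : 0 < r by rewrite divr_gt0 // subr_gt0.
    have /clv[w [/Dphi Dw]] : nbhs v (ball v (e * r)).
      by apply: nbhsx_ballx; exact: mulr_gt0.
    rewrite -ball_normE /= => /(near _ _ r0) vw.
    have := support_sub sphi (v - w) w; rewrite subrK /r in vw *; lra.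
  apply: niv; apply/nbhs_ballP; exists (e * (1 - phi v)) => /=.
    by rewrite mulr_gt0 // subr_gt0.
  move=> w; rewrite -ball_normE /= distrC => vw; apply/Dphi.
  have := near _ _ (_ : 0 < 1 - phi v) vw; rewrite subr_gt0 => /(_ l).
  by have := support_sub sphi v (w - v); rewrite addrC subrK; lra.
split; first by apply: subset_closure; apply/Dphi; rewrite phiv.
move=> /nbhs_ballP[d d0 dD]; have v1 : 0 < `|v| + 1 by rewrite ltr_wpDl.
have r0 : 0 < d / (`|v| + 1) by rewrite divr_gt0.
have /dD /Dphi : ball v d (v + (d / (`|v| + 1)) *: v).
  rewrite -ball_normE /= opprD addrA subrr sub0r normrN normrZ gtr0_norm //.
  by rewrite mulrAC ltr_pdivrMr // ltr_pM2l // ltrDl.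
have -> : v + (d / (`|v| + 1)) *: v = (1 + d / (`|v| + 1)) *: v.
  by rewrite scalerDl scale1r.
by rewrite (support_homog sphi) ?addr_ge0 ?(ltW r0) // phiv mulr1; lra.
Qed.

End Gauge.

Lemma reflexive_spanning (s : seq 'rV[R]_n) : D = convex_hull s ->
  forall mu : 'cV[R]_n, mu != 0 -> exists2 g, g \in s & 0 < pairing mu g.
Proof.
move=> Ds mu mu0; apply: contrapT => H.
have Hs g : g \in s -> pairing mu g <= 0.
  by move=> gs; rewrite leNgt; apply/negP => l; apply: H; exists g.
have [r r0] := scaled_absorbing mu^T; rewrite Ds => /(convex_hull_le Hs).
by rewrite pairingZr pmulr_rle0 // leNgt pairing_tr_gt0.
Qed.

End Reflexive.

Lemma lattice_points_finite (R : realType) (n : nat) (s : seq 'rV[R]_n) :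
  finite_set [set v | lattice_point v /\ convex_hull s v].
Proof.
have [B HB] : exists B : nat, forall i (v : 'rV[R]_n), convex_hull s v -> `|v 0 i| <= B%:R.
  have [B /(_ _ (leqnn _)) HB] : exists B0, forall B, (B0 <= B)%N ->
      forall i : 'I_n, forall v, convex_hull s v -> `|v 0 i| <= B%:R.
    apply: eventually_forall => i.
    have [b Hb] : exists b, forall g, g \in s -> `|g 0 i| <= b.
      case: s => [|x s]; first by exists 0.
      have [g _ H] := seq_argmax (fun g : 'rV[R]_n => `|g 0 i|) (isT : x :: s != [::]).
      by exists (`|g 0 i|).
    have [B0 HB0] := eventually_natr_ge b; exists B0 => B /HB0 bB v sv.
    apply: le_trans bB; rewrite ler_norml; apply/andP; split.
      rewrite lerNl -pairing_delta -pairingNl.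
      apply: (convex_hull_le _ sv) => g /Hb; rewrite pairingNl pairing_delta ler_norml lerNl.
      by case/andP.
    rewrite -pairing_delta; apply: (convex_hull_le _ sv) => g /Hb.
    by rewrite pairing_delta ler_norml => /andP[].
  by exists B.
(* The integers from [-B] to [B] are coded as ordinals shifted by [B]. *)
pose g (f : 'rV['I_(B + B).+1]_n) : 'rV[R]_n := map_mx (fun o : 'I_ _ => o%:R - B%:R) f.
apply: (@sub_finite_set _ _ (range g)); last exact: finite_image.
move=> v [/mxOverP lv sv]; exists (\row_i inord (absz (Num.floor (v 0 i + B%:R)))) => //.
apply/rowP => i; rewrite !mxE.
have vB0 : 0 <= v 0 i + B%:R by have := HB i v sv; rewrite ler_norml; lra.
have e : (absz (Num.floor (v 0 i + B%:R)))%:R = v 0 i + B%:R.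
  rewrite natr_absz ger0_norm ?floor_ge0 // floorK // rpredD ?rpred_nat //; exact: lv.
rewrite inordK ?e ?addrK // ltnS -(ler_nat R) e natrD.
by have := HB i v sv; rewrite ler_norml; lra.
Qed.

Lemma lattice_enum (R : realType) (n : nat) (D : set 'rV[R]_n) (s : seq 'rV[R]_n) :
  D = convex_hull s -> exists (k : nat) (a : 'I_k -> 'rV[R]_n),
  [/\ injective a, forall i, [/\ lattice_point (a i), a i != 0 & D (a i)] &
      forall v, lattice_point v -> v != 0 -> D v -> exists i, v = a i].
Proof.
move=> Ds.
have /finite_seqP[l lE] : finite_set [set v | [/\ lattice_point v, v != 0 & D v]].
  apply: sub_finite_set (lattice_points_finite s) => v [lv _].
  by rewrite Ds.
have lP v : v \in undup l -> [/\ lattice_point v, v != 0 & D v].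
  by rewrite mem_undup => vl; have : [set` l] v by []; rewrite -lE.
exists (size (undup l)), (fun i => (undup l)`_i); split=> [i j|i|v lv v0 Dv].
- by move/eqP; rewrite nth_uniq ?undup_uniq // => /eqP/val_inj.
- by apply: lP; exact: mem_nth.
have vl : v \in undup l.
  by rewrite mem_undup; have : [set` l] v by rewrite -lE.
have ix : (index v (undup l) < size (undup l))%N by rewrite index_mem.
by exists (Ordinal ix); rewrite /= nth_index.
Qed.

(** * Projective fans *)

Section Fans.
Context {R : realType} {n : nat}.
Implicit Types (F : set (set 'rV[R]_n)) (sigma tau : set 'rV[R]_n).

(** Among the members containing [sigma], take one that contains the largest number of members of
    [F]; a strictly larger cone would also count itself. *)
Lemma fan_maximal F sigma : finite_set F -> F sigma ->
  exists2 tau, maximal_cone F tau & sigma `<=` tau.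
Proof.
move=> /finite_seqP[l ->] sl.
pose above := [seq tau <- l | `[< sigma `<=` tau >]].
have sa : sigma \in above by rewrite mem_filter sl andbT; apply/asboolP.
have a0 : above != [::] by apply: contraTneq sa => ->.
pose w tau : R := (count (fun rho => `[< rho `<=` tau >]) l)%:R.
have [tau] := seq_argmax w a0.
rewrite mem_filter => /andP[/asboolP st tl] tmax; exists tau => //; split=> // rho rl tr.
apply: contrapT => nrt.
have := tmax rho; rewrite mem_filter rl andbT => /(_ (asboolT (subset_trans st tr))).
rewrite /w ler_nat leqNgt => /negP; apply.
have sub : subpred (fun x : set 'rV[R]_n => `[< x `<=` tau >]) (fun x => `[< x `<=` rho >]).
  by move=> x /asboolP xt; apply/asboolP; exact: subset_trans xt tr.
rewrite ltn_neqAle sub_count // andbT; apply/negP => /eqP e.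
have : all [pred x | `[< x `<=` rho >] ==> `[< x `<=` tau >]] l.
  elim: (l) e => //= x r IH; case: (boolP `[< x `<=` tau >]) => [/sub -> /=|_].
    by rewrite !add1n => -[] /IH.
  case: `[< x `<=` rho >] => /=; rewrite ?add0n // add1n => e.
  by have := sub_count sub r; rewrite e ltnn.
move=> /allP /(_ rho rl) /=; have -> : `[< rho `<=` rho >] by apply/asboolP.
by move=> /asboolP rt; apply: nrt; apply/seteqP.
Qed.

Lemma complete_maximal F : is_fan F -> complete_fan F ->
  forall v, exists2 sigma, maximal_cone F sigma & sigma v.
Proof.
move=> fF cF v; have [sigma Fs sv] := cF v.
by have [tau tm st] := fan_maximal (fan_finite fF) Fs; exists tau => //; exact: st.
Qed.

Lemma conic_comb (s : seq 'rV[R]_n) r r' x y : 0 <= r -> 0 <= r' ->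
  conic_hull s x -> conic_hull s y -> conic_hull s (r *: x + r' *: y).
Proof.
move=> r0 r'0 [c [c0 ->]] [d [d0 ->]]; exists (fun i => r * c i + r' * d i).
split=> [i|]; first by rewrite addr_ge0 // mulr_ge0.
rewrite !scaler_sumr -big_split /=; apply: eq_bigr => i _.
by rewrite !scalerA -scalerDl.
Qed.

Lemma rational_comb sigma r r' x y : rational_cone sigma -> 0 <= r -> 0 <= r' ->
  sigma x -> sigma y -> sigma (r *: x + r' *: y).
Proof. by move=> [s [_ ->]]; exact: conic_comb. Qed.

Section ProjectiveSupport.
Variables (F : set (set 'rV[R]_n)) (phi : 'rV[R]_n -> R).
Hypotheses (fanF : is_fan F) (complF : complete_fan F).
Hypothesis phi_convex : convex_function (E := 'rV[R]_n) setT phi.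
Hypothesis phi_max : forall sigma, maximal_cone F sigma ->
  exists2 m : 'cV[R]_n, lattice_point m & forall v, phi v = pairing m v <-> sigma v.

Let homog r v : 0 <= r -> phi (r *: v) = r * phi v.
Proof.
move=> r0; have [sigma sm sv] := complete_maximal fanF complF v.
have [m _ mP] := phi_max sm; rewrite (mP v).2 // (mP (r *: v)).2 ?pairingZr //.
have := rational_comb (fan_rational fanF sm.1) r0 (lexx 0) sv sv.
by rewrite scale0r addr0.
Qed.

Let subadd x y : phi (x + y) <= phi x + phi y.
Proof.
have h0 : 0 <= 2^-1 :> R by lra.
have h1 : 2^-1 <= 1 :> R by lra.
have H : phi (2^-1 *: x + (1 - 2^-1) *: y) <= 2^-1 * phi x + (1 - 2^-1) * phi y.
  by apply: (phi_convex (Itv01 h0 h1)); rewrite in_setE.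
move: H; rewrite (_ : 1 - 2^-1 = 2^-1); last by lra.
by rewrite -scalerDr homog // -mulrDr ler_pM2l // invr_gt0.
Qed.

(* A linear piece of [phi] lies below [phi]: otherwise, leaving a relative
   interior point [x] of its cone in a direction [- y] with [phi y < m y], one
   stays in a single other cone [tau] along a sequence tending to [x]; then [x]
   is in [tau], and the fan axioms force [tau] to be the cone itself. *)
Lemma phi_max_below sigma m : maximal_cone F sigma ->
  (forall v, phi v = pairing m v <-> sigma v) -> forall v, pairing m v <= phi v.
Proof.
move=> sm mP y; rewrite leNgt; apply/negP => ylt.
have [s [_ sE]] := fan_rational fanF sm.1.
(* The sum of the generators is a relative interior point of [sigma]. *)
pose x := \sum_(i < size s) 1 *: s`_i.
have sx : sigma x by rewrite sE; exists (fun=> 1); split.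
pose z j := x - (j.+1%:R)^-1 *: y.
have phiz sub m' : (forall v, phi v = pairing m' v <-> sub v) -> forall j, sub (z j) ->
    phi x - pairing m' x <= (phi y - pairing m' y) / j.+1%:R.
  move=> H j /H e; have := subadd (z j) ((j.+1%:R)^-1 *: y).
  rewrite /z subrK homog ?invr_ge0 // -/(z j) e /z pairingBr pairingZr.
  by move: (_^-1) => u; lra.
(* Pigeonhole: finitely many maximal cones cover the infinite sequence [z]. *)
have [tau tm tP] : exists2 tau, maximal_cone F tau &
    forall K, exists2 j, (K <= j)%N & tau (z j).
  apply: contrapT => H.
  have [l lE] := (finite_seqP _).1 (fan_finite fanF).
  have [K HK] : exists K, forall tau, tau \in l -> maximal_cone F tau ->
      forall j, (K <= j)%N -> ~ tau (z j).
    elim: (l) => [|rho r [K HK]]; first by exists 0%N.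
    have [K' HK'] : exists K', maximal_cone F rho ->
        forall j, (K' <= j)%N -> ~ rho (z j).
      have [rm|nrm] := pselect (maximal_cone F rho); last by exists 0%N.
      apply: contrapT => /forallNP H'; apply: H; exists rho => // K0.
      apply: contrapT => nj; apply: (H' K0) => _ j jK rj; apply: nj; by exists j.
    exists (maxn K K') => tau; rewrite inE => /orP[/eqP -> rm j|tr tm j].
      by rewrite geq_max => /andP[_]; exact: HK'.
    by rewrite geq_max => /andP[+ _]; exact: HK.
  have [tau tm tz] := complete_maximal fanF complF (z K).
  apply: (HK tau _ tm K (leqnn K) tz).
  by have := tm.1; rewrite lE.
have [m' _ m'P] := phi_max tm.
have small (b c : R) : (forall K, exists2 j, (K <= j)%N & b <= c / j.+1%:R) -> b <= 0.
  move=> H; rewrite leNgt; apply/negP => b0.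
  have [N0 HN] := eventually_natr_ge (c / b); have [j /HN jN] := H N0.
  rewrite ler_pdivlMr ?ltr0n // => bc.
  move: jN; rewrite ler_pdivrMr // => cj.
  have := le_trans bc cj; rewrite mulrC ler_pM2r // ler_nat ltnn. by [].
have tx : tau x.
  apply/m'P/eqP; rewrite eq_le; apply/andP; split; rewrite -subr_le0.
    apply: (small _ (phi y - pairing m' y)) => K; have [j Kj tj] := tP K.
    by exists j => //; exact: phiz m'P _ tj.
  apply: (small _ (phi (- y) + pairing m' y)) => K; have [j Kj tj] := tP K.
  exists j => //; have := subadd x ((j.+1%:R)^-1 *: - y).
  rewrite homog ?invr_ge0 // scalerN -/(z j) ((m'P _).2 tj) /z pairingBr pairingZr.
  by move: (_^-1) => u; lra.
(* The intersection is the face of [sigma] on which [mu] vanishes. As [mu] is nonnegative on the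
   generators and zero on their sum [x], that face is all of [sigma]. *)
have st : sigma `<=` tau.
  have [[mu [mu0 muE]] _] := fan_meet fanF sm.1 tm.1.
  have ssig i : (i < size s)%N -> sigma s`_i.
    move=> il; rewrite sE; exists (fun j => (j == i)%:R); split=> [j|]; first exact: ler0n.
    rewrite (bigD1 (Ordinal il)) //= eqxx scale1r big1 ?addr0 // => j.
    by rewrite -val_eqE /= => /negbTE ->; rewrite scale0r.
  have mux : pairing mu x = 0.
    by have : (sigma `&` tau) x by []; rewrite muE => -[].
  have mus i : (i < size s)%N -> pairing mu s`_i = 0.
    move=> il; move: mux => /eqP; rewrite pairing_comb psumr_eq0; last first.
      by move=> j _; rewrite mul1r; apply: mu0; exact: ssig.
    by move=> /allP /(_ (Ordinal il) (mem_index_enum _)); rewrite /= mul1r => /eqP.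
  move=> v sv; suff : (sigma `&` tau) v by case.
  rewrite muE; split=> //=; move: sv; rewrite sE => -[c [_ ->]].
  by rewrite pairing_comb big1 // => i _; rewrite mus ?mulr0.
have te := sm.2 _ tm.1 st; rewrite te in tP.
have [j _ sj] := tP 0%N; have := phiz _ _ mP j sj.
rewrite ((mP x).2 sx) subrr pmulr_lge0 ?invr_gt0 // subr_ge0; lra.
Qed.

Lemma projective_support :
  support_function [set m | lattice_point m /\ exists2 sigma, maximal_cone F sigma &
    forall v, phi v = pairing m v <-> sigma v] phi.
Proof.
split=> [m [_ [sigma sm mP]] v|v]; first exact: phi_max_below sm mP v.
have [sigma sm sv] := complete_maximal fanF complF v.
have [m ml mP] := phi_max sm; exists m; last exact/mP.
by split=> //; exists sigma.
Qed.

End ProjectiveSupport.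

Definition linearly_independent (s : seq 'rV[R]_n) := forall c : nat -> R,
  \sum_(i < size s) c i *: s`_i = 0 -> forall i, (i < size s)%N -> c i = 0.

(** The simplex lies in the boundary, where the gauge is 1, so its vertices lie on a hyperplane
    avoiding the origin. This turns affine independence into linear independence. *)
Lemma maximal_MPCP (D : set 'rV[R]_n) F sigma : reflexive_polytope D -> MPCP D F ->
  maximal_cone F sigma -> exists s : seq 'rV[R]_n,
  [/\ linearly_independent s, sigma `<=` conic_hull s &
    forall g, g \in s -> [/\ lattice_point g, D g, g != 0 & sigma g]].
Proof.
move=> rD mF sm; have [S [[s [aff lat SE _]] SD sE]] := MPCP_maximal mF sm.
have [_ [P [phi [_ sphi _ Dphi]]]] := reflexive_support rD.
have bnd := reflexive_boundary rD sphi Dphi.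
have s1 g : g \in s -> phi g = 1.
  by move=> gs; apply/bnd/SD; rewrite SE; exact: mem_convex_hull.
exists s; split.
- move=> c c0 i il; apply: (aff c) => //.
  have s0 : (0 < size s)%N by exact: leq_ltn_trans il.
  have [|m Pm mP] := @support_common _ _ _ _ sphi 'I_(size s) [set: _]%SET (fun j => s`_j).
    rewrite (eq_bigr (fun=> 1)) => [|j _]; last by apply: s1; exact: mem_nth.
    rewrite sumr_const cardsT card_ord.
    (* The barycentre is a boundary point, so the gauge is additive on the sum of the vertices. *)
    have -> : \sum_(j in [set: 'I_(size s)]%SET) s`_j =
        (size s)%:R *: (\sum_(j < size s) (size s)%:R^-1 *: s`_j).
      rewrite scaler_sumr.
      under [RHS]eq_bigr do rewrite scalerA mulfV ?pnatr_eq0 -?lt0n // scale1r.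
      by apply: eq_bigl => j; rewrite inE.
    rewrite (support_homog sphi) ?ler0n // (bnd _).1 ?mulr1 //; apply: SD; rewrite SE.
    exists (fun=> (size s)%:R^-1); split=> //.
    by rewrite sumr_const card_ord -[LHS]mulr_natl mulfV // pnatr_eq0 -lt0n.
  have H := congr1 (pairing m) c0; rewrite pairing0r pairing_comb in H; rewrite -[RHS]H.
  apply: eq_bigr => j _; rewrite -mP ?inE // s1 ?mulr1 //; exact: mem_nth.
- rewrite sE => _ [r [y [r0 + ->]]]; rewrite SE => -[c [c0 _ ->]].
  exists (fun i => r * c i); split=> [i|]; first exact: mulr_ge0.
  by rewrite scaler_sumr; apply: eq_bigr => i _; rewrite scalerA.
- move=> g gs; split; first exact: lat.
  + by apply/Dphi; rewrite s1.
  + apply/eqP => g0; have := s1 g gs; rewrite g0 (support0 sphi) => /eqP.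
    by rewrite eq_sym oner_eq0.
  rewrite sE; exists 1, g; split=> //; last by rewrite scale1r.
  by rewrite SE; exact: mem_convex_hull.
Qed.

End Fans.

Lemma linearly_independent_rank (R : realType) (n : nat) (s : seq 'rV[R]_n) :
  linearly_independent s -> \rank (\matrix_(i < size s) s`_i) = size s.
Proof.
move=> li; apply/eqP; rewrite -/(row_free _) -kermx_eq0; apply/eqP/row_matrixP => i.
set M := \matrix_i s`_i; set w := row i _; rewrite row0.
have wM : w *m M = 0 by rewrite -row_mul mulmx_ker row0.
apply/rowP => j; rewrite [RHS]mxE.
pose c l := if insub l is Some l' then w 0 (l' : 'I_(size s)) else 0.
have := li c; have -> : \sum_(l < size s) c l *: s`_l = 0.
  rewrite -[RHS]wM mulmx_sum_row; apply: eq_bigr => l _.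
  by rewrite /c valK rowK.
by move=> /(_ erefl j (ltn_ord j)); rewrite /c valK.
Qed.

Lemma linearly_independent_full (R : realType) (n : nat) (s : seq 'rV[R]_n)
    (v : 'rV[R]_n) :
  linearly_independent s -> size s = n ->
  exists c : nat -> R, v = \sum_(i < size s) c i *: s`_i.
Proof.
move=> /linearly_independent_rank; set M := \matrix_i _ => rM sn.
have fM : row_full M by rewrite /row_full rM sn.
pose w := v *m pinvmx M.
exists (fun l => if insub l is Some l' then w 0 (l' : 'I_(size s)) else 0).
have : w *m M = v by rewrite mulmxKpV // submx_full.
rewrite mulmx_sum_row => {1}<-; apply: eq_bigr => l _.
by rewrite valK rowK.
Qed.

(** * Decomposition into boundary lattice points *)

Section Representation.
Context {R : realType} {n k : nat}.
Variables (a : 'I_k -> 'rV[R]_n) (P1 P2 : set 'cV[R]_n).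
Variables (phi1 phi2 : 'rV[R]_n -> R) (C : R).
Hypotheses (C_ge0 : 0 <= C).
Hypotheses (s1 : support_function P1 phi1) (s2 : support_function P2 phi2).
Hypothesis a_lat : forall i, lattice_point (a i).
Hypothesis P2_lat : forall m, P2 m -> lattice_point m.
Hypothesis phi2_gt0 : forall v, v != 0 -> 0 < phi2 v.
Hypothesis phi2_a : forall i, phi2 (a i) = 1.
Hypothesis a_all : forall v, lattice_point v -> v != 0 -> phi2 v <= 1 ->
  exists i, v = a i.

Let psi v := phi1 v + C * phi2 v.

(** Since [psi] is sublinear, the inequality is an equality: [psi] is at [v] the lower envelope of
    its values at the [a i]. *)
Definition representable v := exists c : 'I_k -> R,
  [/\ forall i, 0 <= c i, v = \sum_i c i *: a i & \sum_i c i * psi (a i) <= psi v].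

(** Decompositions can be added wherever [phi1] and [phi2] are both additive. *)
Lemma representable_comb r r' x y : 0 <= r -> 0 <= r' ->
  representable x -> representable y ->
  r * phi1 x + r' * phi1 y <= phi1 (r *: x + r' *: y) ->
  r * phi2 x + r' * phi2 y <= phi2 (r *: x + r' *: y) ->
  representable (r *: x + r' *: y).
Proof.
move=> r0 r'0 [c [c0 xE cx]] [d [d0 yE dy]] le1 le2.
exists (fun i => r * c i + r' * d i); split=> [i||].
- by rewrite addr_ge0 // mulr_ge0.
- rewrite {1}xE {1}yE !scaler_sumr -big_split /=; apply: eq_bigr => i _.
  by rewrite !scalerA -scalerDl.
rewrite (eq_bigr (fun i => r * (c i * psi (a i)) + r' * (d i * psi (a i)))); last first.
  by move=> i _; ring.
rewrite big_split /= -!mulr_sumr.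
have := ler_wpM2l r0 cx; have := ler_wpM2l r'0 dy; have := ler_wpM2l C_ge0 le2.
rewrite /psi; lra.
Qed.

Lemma representable_gen i : representable (a i).
Proof.
exists (fun j => (j == i)%:R); split=> [j||]; first exact: ler0n.
  rewrite (bigD1 i) //= eqxx scale1r big1 ?addr0 // => j /negbTE ->.
  by rewrite scale0r.
rewrite (bigD1 i) //= eqxx mul1r big1 ?addr0 // => j /negbTE ->.
by rewrite mul0r.
Qed.

Lemma representable_scale r x : 0 <= r -> representable x -> representable (r *: x).
Proof.
move=> r0 rx; have := representable_comb r0 (lexx 0) rx rx.
rewrite scale0r addr0 !mul0r !addr0 (support_homog s1) // (support_homog s2) //.
by apply.
Qed.

(* Two boundary lattice points [p], [q] with [phi2 (p + q) = 2] lie on a common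
   facet.  Otherwise [phi2 (p + q) = 1] by integrality, so that [p + q] is again
   a boundary lattice point and the cone can be cut along it; this ends since
   there are finitely many boundary lattice points. *)
Lemma representable2 m i j : P1 m ->
  phi1 (a i) = pairing m (a i) -> phi1 (a j) = pairing m (a j) ->
  (forall r r', r *: a i + r' *: a j = 0 -> r = 0 /\ r' = 0) ->
  forall r r', 0 <= r -> 0 <= r' -> representable (r *: a i + r' *: a j).
Proof.
move=> Pm.
(* The induction is on the number of [a l] in the cone spanned by [a p] and [a q]; replacing [a q]
   by [a p + a q] loses at least [a q]. *)
pose cn p q := [set l : 'I_k | `[< exists r r',
  [/\ 0 <= r, 0 <= r' & a l = r *: a p + r' *: a q] >]]%SET.
elim: {i j}#|cn i j| {-2}i {-2}j (leqnn #|cn i j|) => [|d IH] i j.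
  rewrite leqn0 cards_eq0 => /eqP c0; have : i \in cn i j; last by rewrite c0 inE.
  rewrite finset.in_set; apply/asboolP; exists 1, 0.
  by split; rewrite // scale1r scale0r addr0.
move=> cd li lj ind r r' r0 r'0.
have sum0 : a i + a j != 0.
  apply/eqP => e; have := ind 1 1; rewrite !scale1r => /(_ e)[/eqP].
  by rewrite oner_eq0.
have lat_sum := lattice_pointD (a_lat i) (a_lat j).
have [le1|gt1] := leP (phi2 (a i + a j)) 1; last first.
  have ge2 : 2 <= phi2 (a i + a j).
    have : 1 <= phi2 (a i + a j) - 1.
      by apply: int_gt0_ge1; rewrite ?subr_gt0 // rpredB ?(support_int s2) // rpred1.
    by lra.
  have [m2 P2m e2] := s2.2 (a i + a j).
  have := s2.1 _ P2m (a i); have := s2.1 _ P2m (a j); rewrite !phi2_a => l2 l2'.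
  rewrite e2 pairingDr in ge2.
  apply: representable_comb => //; try exact: representable_gen.
    by rewrite (support_linear s1 Pm) // pairingDr !pairingZr li lj.
  have mi : pairing m2 (a i) = 1 by lra.
  have mj : pairing m2 (a j) = 1 by lra.
  by rewrite (support_linear s2 P2m) ?phi2_a // pairingDr !pairingZr mi mj.
have [l lE] := a_all lat_sum sum0 le1.
have ll : phi1 (a l) = pairing m (a l).
  have := support_linear s1 Pm ler01 ler01 li lj.
  by rewrite !scale1r lE.
have half p q : phi1 (a p) = pairing m (a p) ->
    (forall r r', r *: a p + r' *: a q = 0 -> r = 0 /\ r' = 0) ->
    a l = a p + a q -> (#|cn p q| <= d.+1)%N ->
    forall r r', 0 <= r -> 0 <= r' -> representable (r *: a p + r' *: a l).
  move=> lp indp lE' cpq; apply: IH => //.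
    rewrite -ltnS; apply: leq_trans cpq; apply: proper_card.
    rewrite properE; apply/andP; split.
      apply/fintype.subsetP => o; rewrite !finset.in_set => /asboolP[u [u' [u0 u'0 oE]]].
      apply/asboolP; exists (u + u'), u'; split=> //; first exact: addr_ge0.
      by rewrite oE lE' scalerDr addrA -scalerDl.
    apply/subsetPn; exists q; rewrite !finset.in_set.
      by apply/asboolP; exists 0, 1; rewrite scale0r scale1r add0r.
    apply/asboolP => -[u [u' [u0 u'0]]]; rewrite lE' scalerDr addrA -scalerDl => e.
    have := indp (u + u') (u' - 1).
    by rewrite scalerBl scale1r addrA -e subrr => /(_ erefl)[]; lra.
  move=> u u'; rewrite lE' scalerDr addrA -scalerDl => /indp[]; lra.
(* The smaller coefficient decides on which side of the cut along [a i + a j] the point lies. *)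
have [rr|rr] := leP r' r.
  have := half i j li ind (esym lE) cd (r - r') r'.
  rewrite -lE scalerDr addrA -scalerDl subrK; apply=> //.
  by rewrite subr_ge0.
have cs : cn j i = cn i j.
  apply/setP => o; rewrite !finset.in_set; apply/asboolP/asboolP => -[u [u' [u0 u'0 ->]]];
  by exists u', u; rewrite addrC.
have := half j i lj _ _ _ (r' - r) r; rewrite -lE scalerDr addrCA -scalerDl subrK; apply=> //.
- by move=> u u'; rewrite addrC => /ind[].
- exact: addrC.
- by rewrite cs.
- by rewrite subr_ge0 ltW.
Qed.

Lemma representable0 : representable 0.
Proof.
exists (fun=> 0); split=> //; first by rewrite big1 // => i _; rewrite scale0r.
rewrite big1 => [|i _]; last by rewrite mul0r.
by rewrite /psi (support0 s1) (support0 s2) mulr0 addr0.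
Qed.

Section Simplex.
Variables (m : 'cV[R]_n) (s : seq 'rV[R]_n).
Hypotheses (Pm : P1 m) (li : linearly_independent s).
Hypothesis s_a : forall g, g \in s -> phi1 g = pairing m g /\ exists i, g = a i.

Lemma linear_on_hull v : conic_hull s v -> phi1 v = pairing m v.
Proof.
move=> [c [c0 ->]]; apply/le_anti; rewrite (s1.1 _ Pm) andbT.
have := @support_comb _ _ _ _ s1 _ [set: 'I_(size s)]%SET c (fun i => s`_i) c0.
under eq_bigl do rewrite inE.
under [X in _ <= X -> _]eq_bigl do rewrite inE.
move=> /le_trans; apply; rewrite pairing_comb; apply: ler_sum => i _.
by have [->] := s_a (mem_nth 0 (ltn_ord i)).
Qed.

Lemma representable_pair p q r r' : (p < size s)%N -> (q < size s)%N -> p != q ->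
  0 <= r -> 0 <= r' -> representable (r *: s`_p + r' *: s`_q).
Proof.
move=> ps qs pq r0 r'0.
have [lp [i ip]] := s_a (mem_nth 0 ps); have [lq [j jq]] := s_a (mem_nth 0 qs).
rewrite ip jq; apply: (representable2 Pm) => //; rewrite -?ip -?jq //.
move=> u u' e; pose c l := if l == p then u else if l == q then u' else 0.
have c0 : \sum_(l < size s) c l *: s`_l = 0.
  rewrite (bigD1 (Ordinal ps)) //= (bigD1 (Ordinal qs)) /=; last first.
    by rewrite -val_eqE /= eq_sym.
  rewrite /c !eqxx eq_sym (negbTE pq) big1 ?addr0 // => l.
  by rewrite -!val_eqE /= => /andP[/negbTE -> /negbTE ->]; rewrite scale0r.
split; first by have := li c0 ps; rewrite /c eqxx.
by have := li c0 qs; rewrite /c eqxx eq_sym (negbTE pq).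
Qed.

Lemma representable_facet (c : nat -> R) : size s = 3 -> (forall i, (i < 3)%N -> 0 <= c i) ->
  (exists2 i, (i < 3)%N & c i = 0) -> representable (\sum_(i < size s) c i *: s`_i).
Proof.
move=> s3 c0 [i i3 ci].
have -> : \sum_(i < size s) c i *: s`_i = c 0%N *: s`_0 + c 1%N *: s`_1 + c 2%N *: s`_2.
  rewrite -(big_mkord xpredT (fun i => c i *: s`_i)) s3 /index_iota /=.
  by rewrite !big_cons big_nil addr0 addrA.
case: i ci i3 => [|[|[|//]]] -> _; rewrite scale0r ?add0r ?addr0;
  by apply: representable_pair; rewrite ?s3 ?c0.
Qed.

(** Follow the ray from [v] in direction [g]. A cone with at most two generators is settled
    directly; otherwise [s] is a basis and the coordinates tell when the ray leaves the cone. *)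
Lemma representable_exit v g : (n <= 3)%N -> conic_hull s v -> representable v \/
  exists e t, [/\ 0 <= e, 0 < t, phi1 (e *: v + t *: g) = pairing m (e *: v + t *: g) &
    representable g -> representable (e *: v + t *: g)].
Proof.
move=> n3 [c [c0 vE]].
have : (size s <= n)%N by rewrite -(linearly_independent_rank li) rank_leq_col.
case es : (size s) => [|[|[|[|k']]]] sn; last by have := leq_trans sn n3.
- left; rewrite vE; have -> : \sum_(i < size s) c i *: s`_i = 0; last exact: representable0.
  by apply: big1 => i _; have := ltn_ord i; rewrite [X in (_ < X)%N]es.
- left; rewrite vE -(big_mkord xpredT (fun i => c i *: s`_i)) es /index_iota /= big_seq1.
  apply: representable_scale => //.
  have [|_ [i ->]] := s_a (mem_nth 0 (_ : (0 < size s)%N)); first by rewrite es.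
  exact: representable_gen.
- left; rewrite vE -(big_mkord xpredT (fun i => c i *: s`_i)) es /index_iota /=.
  rewrite !big_cons big_nil addr0; apply: representable_pair; by rewrite ?es.
have sn' : size s = n by rewrite es; apply/eqP; rewrite eqn_leq sn n3.
have [d gE] := linearly_independent_full g li sn'.
have [d0|] := pselect (forall i, (i < 3)%N -> 0 <= d i).
  (* If [g] itself lies in the cone, it is the point reached. *)
  right; exists 0, 1; rewrite scale0r scale1r add0r; split=> //.
  apply: linear_on_hull; exists (fun i => if (i < 3)%N then d i else 0); split.
    by move=> i; case: ifP => // /d0.
  by rewrite gE; apply: eq_bigr => i _; rewrite -es ltn_ord.
move=> /existsNP[i0 /not_implyP[i03 /negP]]; rewrite -ltNge => di0.
(* [F i] is the time at which coordinate [i] of [v + t *: g] vanishes; the first such time puts the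
   point on a face with two generators. *)
pose F (i : 'I_3) := c i / - d i.
have Pi0 : d (Ordinal i03) < 0 by [].
case: (@arg_minP _ _ _ (Ordinal i03) (fun i : 'I_3 => d i < 0) F Pi0) => i1 di1 i1m.
have t0 : 0 <= F i1 by rewrite divr_ge0 // oppr_ge0 ltW.
have co i : (i < 3)%N -> 0 <= c i + F i1 * d i.
  move=> i3; have [l|l] := ltP (d i) 0.
    by have /= := i1m (Ordinal i3) l; rewrite {2}/F /= ler_pdivlMr ?oppr_gt0 //; lra.
  by rewrite addr_ge0 // mulr_ge0.
have xE : v + F i1 *: g = \sum_(i < size s) (c i + F i1 * d i) *: s`_i.
  rewrite vE {1}gE scaler_sumr -big_split /=; apply: eq_bigr => i _.
  by rewrite scalerA -scalerDl.
have rx : representable (v + F i1 *: g).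
  rewrite xE; apply: (@representable_facet (fun i => c i + F i1 * d i)) => //.
  by exists i1 => //; rewrite /F; field; rewrite lt_eqF.
(* Exit at time 0 means that [v] already lies on such a face. *)
move: t0; rewrite le_eqVlt => /predU1P[t0|t0].
  by left; rewrite -t0 scale0r addr0 in rx.
right; exists 1, (F i1); rewrite scale1r; split=> //.
apply: linear_on_hull; exists (fun i => if (i < 3)%N then c i + F i1 * d i else 0); split.
  by move=> i; case: ifP => // /co.
by rewrite xE; apply: eq_bigr => i _; rewrite -es ltn_ord.
Qed.

End Simplex.

Hypothesis n_le3 : (n <= 3)%N.
Hypothesis P1_simplex : forall m, P1 m -> exists s : seq 'rV[R]_n,
  [/\ linearly_independent s,
      forall g, g \in s -> phi1 g = pairing m g /\ exists i, g = a i &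
      forall v, phi1 v = pairing m v -> conic_hull s v].

(* Write [v = d g + v'] with [g] a vertex of the facet [m2] and [v'] a
   combination of fewer vertices, and let [m1] be a simplicial cone of [phi1]
   containing [v].  Moving from [v] towards [g], respectively towards [v'], one
   either stays in that cone or leaves it through a face of dimension at most 2;
   [v] is a positive combination of the two points reached. *)
Lemma representable_on_facet m2 (l : seq 'rV[R]_n) (d : nat -> R) : P2 m2 ->
  (forall i, 0 <= d i) ->
  (forall i, (i < size l)%N -> d i = 0 \/
     phi2 l`_i = pairing m2 l`_i /\ exists j, l`_i = a j) ->
  let v := \sum_(i < size l) d i *: l`_i in phi2 v = pairing m2 v /\ representable v.
Proof.
move=> Pm2; elim: l d => [|g l IH] d d0 H /=.
  rewrite big_ord0 pairing0r; split; last exact: representable0.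
  exact: support0 s2.
rewrite big_ord_recl /=; set v' := \sum_(i < size l) _.
have [lv' rv'] : phi2 v' = pairing m2 v' /\ representable v'.
  by apply: (IH (fun i => d i.+1)) => // i il; exact: (H i.+1).
have := H 0%N isT; rewrite /=; have := d0 0%N; rewrite le_eqVlt => /predU1P[<- _|d00].
  by rewrite scale0r add0r.
case=> [e|[lg [j gj]]]; first by rewrite e ltxx in d00.
move: (d 0%N) d00 => {H} d1 d10.
have rg : representable g by rewrite gj; exact: representable_gen.
have [v vdef] : exists v, v = d1 *: g + v' by exists (d1 *: g + v').
rewrite -vdef; have lv : phi2 v = pairing m2 v.
  by rewrite vdef; have := support_linear s2 Pm2 (ltW d10) ler01 lg lv'; rewrite scale1r.
split=> //.
have [m Pm mv] := s1.2 v; have [s [li sa sv]] := P1_simplex Pm.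
have [//|[e [t [e0 t0 l1x rx]]]] := representable_exit Pm li sa g n_le3 (sv v mv).
have [//|[e' [t' [e'0 t'0 l1y ry]]]] := representable_exit Pm li sa v' n_le3 (sv v mv).
have [x xE] : exists x, x = e *: v + t *: g by eexists.
have [y yE] : exists y, y = e' *: v + t' *: v' by eexists.
rewrite -xE in l1x rx; rewrite -yE in l1y ry.
have l2x : phi2 x = pairing m2 x.
  by rewrite xE; apply: (support_linear s2 Pm2) => //; exact: ltW.
have l2y : phi2 y = pairing m2 y.
  by rewrite yE; apply: (support_linear s2 Pm2) => //; exact: ltW.
(* In [(d1 / t) *: x + t'^-1 *: y] the terms in [g] and [v'] add up to [v], and [K] is the total
   coefficient of [v]. *)
pose K := 1 + d1 * e / t + e' / t'.
have K0 : 0 < K.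
  by rewrite /K -addrA ltr_pwDl // addr_ge0 // divr_ge0 ?mulr_ge0 // ltW.
have vE : v = (d1 / t / K) *: x + (t'^-1 / K) *: y.
  have : K *: v = (d1 / t) *: x + t'^-1 *: y.
    rewrite xE yE !scalerDr !scalerA divfK ?gt_eqF // mulVf ?gt_eqF // scale1r.
    rewrite addrACA -vdef -scalerDl -{3}[v]scale1r -scalerDl; congr (_ *: _).
    by rewrite /K; field; rewrite !gt_eqF.
  have scK r (w : 'rV[R]_n) : K *: ((r / K) *: w) = r *: w.
    by rewrite scalerA mulrC divfK // gt_eqF.
  by move=> e1; apply: (scalerI (lt0r_neq0 K0)); rewrite e1 scalerDr !scK.
have A0 : 0 <= d1 / t / K by rewrite !divr_ge0 // ltW.
have B0 : 0 <= t'^-1 / K by rewrite divr_ge0 ?invr_ge0 // ltW.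
rewrite vE; apply: representable_comb => //; [exact: rx | exact: ry | |].
  by rewrite (support_linear s1 Pm) // pairingDr !pairingZr l1x l1y.
by rewrite (support_linear s2 Pm2) // pairingDr !pairingZr l2x l2y.
Qed.

(** Scale [v] to the boundary and write it as a convex combination of generators. A functional
    attaining the gauge there forces every generator with nonzero coefficient onto its face, so that
    [representable_on_facet] applies. *)
Lemma representable_all (s : seq 'rV[R]_n) :
  (forall g, g \in s -> lattice_point g) ->
  (forall v, convex_hull s v <-> phi2 v <= 1) ->
  forall v, representable v.
Proof.
move=> s_lat hull v; have [->|v0] := eqVneq v 0; first exact: representable0.
have p0 := phi2_gt0 v0.
have e1 : phi2 ((phi2 v)^-1 *: v) = 1.
  by rewrite (support_homog s2) ?invr_ge0 ?(ltW p0) // mulVf // gt_eqF.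
have [d [d0 d1 vE]] : convex_hull s ((phi2 v)^-1 *: v) by apply/hull; rewrite e1.
have -> : v = phi2 v *: ((phi2 v)^-1 *: v) by rewrite scalerA mulfV ?scale1r // gt_eqF.
apply: representable_scale; first exact: ltW.
have [m Pm e2] := s2.2 ((phi2 v)^-1 *: v).
have les i : (i < size s)%N -> phi2 s`_i <= 1.
  by move=> il; apply/hull; apply: mem_convex_hull; exact: mem_nth.
rewrite vE; apply: (representable_on_facet Pm d0 _).2 => i il.
have eq0 : \sum_(i < size s) d i * (1 - pairing m s`_i) = 0.
  under eq_bigr do rewrite mulrBr mulr1.
  by rewrite sumrB d1 -pairing_comb -vE -e2 e1 subrr.
have lem (j : 'I_(size s)) : 0 <= d j * (1 - pairing m s`_j).
  by rewrite mulr_ge0 // subr_ge0; apply: le_trans (les _ (ltn_ord j)); exact: s2.1.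
move: eq0 => /eqP; rewrite psumr_eq0 => [/allP|j _]; last exact: lem.
move=> /(_ (Ordinal il) (mem_index_enum _)); rewrite /= mulf_eq0.
move=> /orP[/eqP|]; [by left|rewrite subr_eq0 eq_sym => /eqP ei; right].
have ep : phi2 s`_i = 1 by apply/le_anti; rewrite les //= -ei s2.1.
split; first by rewrite ep ei.
apply: a_all; rewrite ?ep //; first by apply: s_lat; exact: mem_nth.
apply/eqP => si0; move: ei; rewrite si0 pairing0r => /eqP.
by rewrite eq_sym oner_eq0.
Qed.

End Representation.

(** * The refined fan *)

Section FanOfHeights.
Context {R : realType} {n k : nat}.
Variables (D : set 'rV[R]_n) (P : set 'cV[R]_n) (phi : 'rV[R]_n -> R).
Variables (a : 'I_k -> 'rV[R]_n) (h : 'I_k -> R).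
Hypothesis n_gt0 : (0 < n)%N.
Hypotheses (rD : reflexive_polytope D) (sphi : support_function P phi).
Hypothesis P_lat : forall m, P m -> lattice_point m.
Hypothesis Dphi : forall v, D v <-> phi v <= 1.
Hypothesis a_lat : forall i, lattice_point (a i).
Hypothesis phi_a : forall i, phi (a i) = 1.
Hypothesis a_all : forall v, lattice_point v -> phi v = 1 -> exists i, v = a i.
Hypothesis h_int : forall i, h i \is a Num.int.
Hypothesis h_gt0 : forall i, 0 < h i.
Hypothesis a_span : forall mu : 'cV[R]_n, mu != 0 -> exists i, 0 < pairing mu (a i).
Hypothesis tight_independent : forall m, feasible a h m -> independent_on a (tight a h m).
Hypothesis tight_common : forall m, feasible a h m -> exists2 p, P p &
  forall i, i \in tight a h m -> pairing p (a i) = 1.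
Hypothesis tight_hull : forall m, feasible a h m -> forall (c : 'I_k -> R) j,
  (forall i, 0 <= c i) -> \sum_(i in tight a h m) c i = 1 ->
  a j = \sum_(i in tight a h m) c i *: a i -> j \in tight a h m.

Lemma cone_on_strongly_convex m : feasible a h m ->
  strongly_convex (cone_on a (tight a h m)).
Proof.
move=> Qm _ [c [c0 ->]] [d [d0 /eqP]]; rewrite eq_sym -addr_eq0 -big_split /= => /eqP e.
have sum0 : \sum_(j in tight a h m) (d j + c j) *: a j = 0.
  by rewrite -[RHS]e; apply: eq_bigr => j _; rewrite scalerDl.
apply: big1 => i iT.
have /= := @tight_independent m Qm (fun j => d j + c j) sum0 i iT.
by have := c0 i; have := d0 i => l l' e'; rewrite (_ : c i = 0) ?scale0r //; lra.
Qed.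

Let phi_comb m (c : 'I_k -> R) : feasible a h m -> (forall i, 0 <= c i) ->
  phi (\sum_(i in tight a h m) c i *: a i) = \sum_(i in tight a h m) c i.
Proof.
move=> Qm c0; apply/le_anti/andP; split.
  apply: le_trans (support_comb sphi _ _ c0) _.
  by under eq_bigr do rewrite phi_a mulr1.
have [p Pp pT] := tight_common Qm; apply: le_trans (sphi.1 _ Pp _).
by rewrite pairing_comb; apply: ler_sum => i iT; rewrite pT // mulr1.
Qed.

Lemma height_fan_refines_faces : refines (height_fan a h) (face_fan D).
Proof.
move=> _ [m Qm ->]; have [p Pp pT] := tight_common Qm.
have [T0|[i0 i0T]] := set_0Vmem (tight a h m).
  exists [set 0]; first by left.
  by rewrite T0 => _ [c [_ ->]]; rewrite big_set0.
(* Faces are loci of minima, while [p] attains its maximum 1 on [D] here; hence the signs. *)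
pose G := D `&` [set v | pairing (- p) v = -1].
have Ga i : i \in tight a h m -> G (a i).
  by move=> iT; split=> /=; [apply/Dphi; rewrite phi_a | rewrite pairingNl pT].
exists (cone G).
  right; exists G => //; split.
  - exists (- p), (-1); split=> // v /Dphi phiv; rewrite pairingNl lerN2.
    exact: le_trans (sphi.1 _ Pp _) phiv.
  - by exists (a i0); exact: Ga.
  - move=> GD; have : G 0 by rewrite GD; apply/Dphi; rewrite (support0 sphi).
    by move=> [_ /=]; rewrite pairing0r => /eqP; rewrite eq_sym oppr_eq0 oner_eq0.
move=> v [c [c0 vE]]; pose r := \sum_(i in tight a h m) c i.
have r0 : 0 <= r by exact: sumr_ge0.
have phiv : phi v = r by rewrite vE phi_comb.
have pv : pairing p v = r.
  by rewrite vE pairing_comb; apply: eq_bigr => i iT; rewrite pT // mulr1.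
move: (r0); rewrite le_eqVlt => /predU1P[re|rp].
  exists 0, (a i0); split=> //; first exact: Ga.
  rewrite scale0r vE big1 // => i iT; suff -> : c i = 0 by rewrite scale0r.
  have /esym/eqP := re; rewrite psumr_eq0 // => /allP /(_ i (mem_index_enum _)).
  by rewrite iT => /eqP.
exists r, (r^-1 *: v); split=> //; last by rewrite scalerA mulfV ?scale1r // gt_eqF.
split=> /=; last by rewrite pairingNl pairingZr pv mulVf // gt_eqF.
by apply/Dphi; rewrite (support_homog sphi) ?invr_ge0 // phiv mulVf // gt_eqF.
Qed.

Lemma height_fan_MPCP : MPCP D (height_fan a h).
Proof.
have bnd := reflexive_boundary rD sphi Dphi.
split.
- by apply: height_fan_is_fan => // m; exact: cone_on_strongly_convex.
- exact: height_fan_complete.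
- exact: height_fan_refines_faces.
- exact: height_fan_projective.
- move=> sigma /(maximal_height_fan a_span)[m [Qm sp ->]].
  pose s := [seq a i | i <- enum (tight a h m)].
  have hullE := convex_hull_on a (tight a h m); rewrite -/s in hullE.
  have SD : convex_hull s `<=` boundary D.
    by rewrite hullE => _ [c [c0 c1 ->]]; apply/bnd; rewrite phi_comb.
  exists (convex_hull s); split=> //; last first.
    apply/seteqP; split=> v; last first.
      move=> [r [y [r0 + ->]]]; rewrite hullE => -[c [c0 _ ->]].
      exists (fun i => r * c i); split=> [i|]; first exact: mulr_ge0.
      by rewrite scaler_sumr; apply: eq_bigr => i _; rewrite scalerA.
    move=> [c [c0 vE]]; pose r := \sum_(i in tight a h m) c i.
    have r0 : 0 <= r by exact: sumr_ge0.
    move: (r0); rewrite le_eqVlt => /predU1P[re|rp].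
      have v0 : v = 0.
        rewrite vE big1 // => i iT; suff -> : c i = 0 by rewrite scale0r.
        have /esym/eqP := re; rewrite psumr_eq0 // => /allP /(_ i (mem_index_enum _)).
        by rewrite iT => /eqP.
      have [T0|[i0 i0T]] := set_0Vmem (tight a h m); last first.
        exists 0, (a i0); split=> //; last by rewrite scale0r.
        by apply: mem_convex_hull; apply: map_f; rewrite mem_enum.
      (* An empty tight set cannot span, as the dimension is positive. *)
      exfalso; have /colP/(_ (Ordinal n_gt0))/eqP : delta_mx (Ordinal n_gt0) 0 = 0 :> 'cV[R]_n.
        by apply: sp => i; rewrite T0 inE.
      by rewrite !mxE !eqxx oner_eq0.
    exists r, (r^-1 *: v); split=> //; last by rewrite scalerA mulfV ?scale1r // gt_eqF.
    rewrite hullE; exists (fun i => r^-1 * c i); split=> [i||].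
    - by rewrite mulr_ge0 // invr_ge0.
    - by rewrite -mulr_sumr mulVf // gt_eqF.
    - by rewrite vE scaler_sumr; apply: eq_bigr => i _; rewrite scalerA.
  exists s; split=> //.
  + move=> c c1 cs i il.
    pose f (o : 'I_k) := c (index o (enum (tight a h m))).
    have il' : (i < #|tight a h m|)%N by rewrite /s size_map -cardE in il.
    have := @tight_independent m Qm f _ _ (enum_valP (Ordinal il')).
    rewrite /f index_enum_val; apply; rewrite -[RHS]cs size_map -cardE big_enum_val.
    by apply: eq_bigr => j _; rewrite index_enum_val nth_map_enum.
  + by move=> v /mapP[i _ ->].
  + move=> v Sv lv; have /bnd phiv := SD v Sv.
    have [j vj] := a_all lv phiv; move: Sv; rewrite hullE => -[c [c0 c1 vE]].
    rewrite vj; apply: map_f; rewrite mem_enum; apply: (tight_hull Qm c0 c1).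
    by rewrite -vj.
- move=> u [lu prim] [m Qm uE].
  have u0 : u != 0.
    have l0 : lattice_point (0 : 'rV[R]_n) by apply/mxOverP => i j; rewrite mxE rpred0.
    by apply/eqP => u0; have := prim 0 0%N l0; rewrite mulr0n => /(_ u0).
  have [c [c0 uc]] : cone_on a (tight a h m) u.
    by rewrite -uE; exists 1, u; rewrite scale1r.
  have [i iT] : exists i, i \in tight a h m.
    have [T0|[i iT]] := set_0Vmem (tight a h m); last by exists i.
    by move: u0; rewrite uc T0 big_set0 eqxx.
  (* The ray contains some [a i = r *: u] with [r * phi u = 1]. So [u] is the multiple of [a i] by
     the positive integer [phi u], which is 1 by primitivity. *)
  have : cone [set u] (a i) by rewrite uE; exact: cone_on_gen.
  move=> [r [_ [r0 -> aE]]].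
  have e1 : r * phi u = 1 by rewrite -(support_homog sphi) // -aE phi_a.
  have pu : phi u \is a Num.int by exact: (support_int sphi).
  have pu0 : 0 < phi u by exact: (gauge_gt0 rD sphi Dphi).
  have /natrP[K KE] : phi u \is a Num.nat by rewrite natrEint pu ltW.
  have K1 : K = 1%N.
    apply: (prim (a i)) => //; rewrite aE -scaler_nat -KE scalerA mulrC e1 scale1r //.
  by apply/bnd; rewrite KE K1.
Qed.

End FanOfHeights.

Theorem theorem2p3 (R : realType) (Delta1 Delta2 : set 'rV[R]_3)
    (Sigma1 : set (set 'rV[R]_3)) :
  reflexive_polytope Delta1 ->
  reflexive_polytope Delta2 ->
  Delta1 `<=` Delta2 ->
  MPCP Delta1 Sigma1 ->
  exists Sigma2 : set (set 'rV[R]_3),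
    MPCP Delta2 Sigma2 /\ refines Sigma2 Sigma1.
Proof.
move=> rD1 rD2 sub mpcp1.
have [s [P2 [phi2 [[Ds s_lat] s2 P2_lat Dphi]]]] := reflexive_support rD2.
have [k [a [a_inj aP a_all]]] := lattice_enum Ds.
have phi2_gt0 := gauge_gt0 rD2 s2 Dphi.
have a_lat i : lattice_point (a i) by have [] := aP i.
have phi2_a i : phi2 (a i) = 1.
  have [_ ai0 /Dphi le1] := aP i; apply/le_anti; rewrite le1 /=.
  by apply: int_gt0_ge1; [exact: (support_int s2) | exact: phi2_gt0].
have a_all' v : lattice_point v -> v != 0 -> phi2 v <= 1 -> exists i, v = a i.
  by move=> lv v0 /Dphi; exact: a_all.
have [phi1 [cvx1 max1]] := MPCP_projective mpcp1.
have s1 := projective_support (MPCP_fan mpcp1) (MPCP_complete mpcp1) cvx1 max1.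
set P1 := [set m | _ /\ _] in s1.
(* [phi1] may be negative, as it can be changed by a linear function; [C] makes [psi] positive at
   every [a i]. *)
have [C HC] : exists C : nat, forall i, 1 - phi1 (a i) <= C%:R.
  have [C H] : exists N0, forall N, (N0 <= N)%N -> forall i, 1 - phi1 (a i) <= N%:R.
    by apply: eventually_forall => i; exact: eventually_natr_ge.
  by exists C; exact: H.
have C0 : 0 < C.+1%:R :> R by rewrite ltr0n.
pose psi v := phi1 v + C.+1%:R * phi2 v.
have P1_simplex m : P1 m -> exists s' : seq 'rV[R]_3,
    [/\ linearly_independent s',
        forall g, g \in s' -> phi1 g = pairing m g /\ exists i, g = a i &
        forall v, phi1 v = pairing m v -> conic_hull s' v].
  move=> [_ [sigma sm mP]].
  have [s' [li hull gP]] := maximal_MPCP rD1 mpcp1 sm; exists s'; split=> //.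
    (* Here the inclusion of the polytopes enters: the generators of [Sigma1] are nonzero lattice
       points of [Delta2], hence among the [a i]. *)
    move=> g /gP[lg Dg g0 sg]; split; first exact/mP.
    exact: a_all lg g0 (sub _ Dg).
  by move=> v /mP/hull.
have rep := representable_all (ltW C0) s1 s2 a_lat P2_lat phi2_gt0 phi2_a a_all'
  (leqnn 3) P1_simplex s_lat _.
have {rep} rep : forall v, representable a phi1 phi2 C.+1%:R v.
  by apply: rep => v; rewrite -Ds.
have s_psi := support_add (ltW C0) s1 s2.
have phi1_int i : phi1 (a i) \is a Num.int by apply: (support_int s1) => // m [].
have psi_int i : psi (a i) \is a Num.int by rewrite /psi phi2_a mulr1 rpredD ?rpred_nat.
have psi_gt0 i : 0 < psi (a i).
  by rewrite /psi phi2_a mulr1; have := HC i; rewrite -natr1; lra.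
have [h [h_int h_gt0 hP]] := exists_heights a_lat a_inj s_psi psi_int psi_gt0 rep.
have common m : feasible a h m ->
    (exists2 p, P1 p & forall i, i \in tight a h m -> phi1 (a i) = pairing p (a i)) /\
    (exists2 p, P2 p & forall i, i \in tight a h m -> pairing p (a i) = 1).
  move=> /hP[_ le _]; have [_ [p1 [p2 [Pp1 Pp2 ->]]] e] := support_common s_psi le.
  (* Each of [p1] and [p2] is bounded by its support function and the weight is positive, so
     equality for [psi] splits into two equalities. *)
  have slack i : i \in tight a h m -> phi1 (a i) = pairing p1 (a i) /\ pairing p2 (a i) = 1.
    move=> /e; rewrite phi2_a pairingDl pairingZl => ei.
    have := s1.1 p1 Pp1 (a i); have := s2.1 p2 Pp2 (a i); rewrite phi2_a => l2 l1.
    have := ler_wpM2l (ltW C0) l2 => l2'.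
    have C2 : C.+1%:R * (pairing p2 (a i) - 1) = 0 by lra.
    move: C2 => /eqP; rewrite mulf_eq0 gt_eqF //= subr_eq0 => /eqP p2i.
    by split=> //; lra.
  by split; [exists p1 | exists p2] => // i /slack[].
exists (height_fan a h); split.
  apply: (height_fan_MPCP _ rD2 s2) => //.
  - move=> v lv v1; apply: a_all' => //; last by rewrite v1.
    by apply: contra_eq_neq v1 => ->; rewrite (support0 s2) eq_sym oner_eq0.
  - move=> mu /(reflexive_spanning rD2 Ds)[g gs mug].
    have [i gE] : exists i, g = a i.
      apply: a_all; [exact: s_lat | | by rewrite Ds; exact: mem_convex_hull].
      by apply: contraTneq mug => ->; rewrite pairing0r ltxx.
    by exists i; rewrite -gE.
  - by move=> m /hP[].
  - by move=> m /common[].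
  - by move=> m /hP[].
(* On the cone of [m], [phi1] agrees with the single piece [p], whose locus of agreement is a
   maximal cone of [Sigma1]. *)
move=> _ [m Qm ->]; have [[p Pp pT] _] := common m Qm.
have [_ [sigma sm sP]] := Pp; exists sigma; first by case: sm.
move=> v [c [c0 ->]]; apply/sP/le_anti; rewrite (s1.1 p Pp) andbT.
apply: le_trans (support_comb s1 _ _ c0) _; rewrite pairing_comb.
by apply: ler_sum => i iT; rewrite pT.
Qed.
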